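(* Let $\lambda$ be a frequency such that, for all $k\in\mathbb{N}$, $$\lim_{\mu\to\infty}\frac{\log\big(\#\{(n_1,\dots,n_k)\in\mathbb{N}^k:\lambda_{n_1}+\dots+\lambda_{n_k}=\mu\}\big)}{\mu}=0,$$ where the limit is taken along those real numbers $\mu$ for which the set in question is non-empty. Then $\lambda$ is hypercontractive.
   Context: A frequency is a strictly increasing sequence $\lambda=(\lambda_n)_{n\ge1}$ of non-negative real numbers tending to $\infty$. A $\lambda$-Dirichlet series is a formal series $D=\sum a_ne^{-\lambda_ns}$ with complex coefficients $(a_n)$; it is a $\lambda$-Dirichlet polynomial if only finitely many $a_n$ are non-zero. For $1\le p<\infty$ and a $\lambda$-Dirichlet polynomial $D$, $$\|D\|_p=\lim_{T\to\infty}\Big(\frac1{2T}\int_{-T}^T\Big|\sum_n a_ne^{-\lambda_nit}\Big|^pdt\Big)^{1/p}.$$ The Hardy space $\mathcal{H}_p(\lambda)$ is the completion of the space of $\lambda$-Dirichlet polynomials under $\|\cdot\|_p$; the coefficient functionals $D\mapsto a_n$ extend continuously ($|a_n|\le\|D\|_p$) and elements of $\mathcal{H}_p(\lambda)$ are identified with the formal $\lambda$-Dirichlet series given by their coefficients. For $\sigma\in\mathbb{R}$, the translation operator is $\tau_\sigma(\sum a_ne^{-\lambda_ns})=\sum a_ne^{-\lambda_n\sigma}e^{-\lambda_ns}$. The frequency $\lambda$ is hypercontractive if $\tau_\sigma:\mathcal{H}_p(\lambda)\to\mathcal{H}_q(\lambda)$ is well defined and continuous for every $1\le p<q<\infty$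 and every $\sigma>0$. *)

(* Defs.v *)
From mathcomp Require Import all_boot all_order all_algebra.
From mathcomp Require Import all_classical all_reals all_analysis.
From mathcomp Require Import finmap complex.

Set Implicit Arguments.
Unset Strict Implicit.
Unset Printing Implicit Defensive.

Import Order.TTheory GRing.Theory Num.Theory.
Import numFieldNormedType.Exports.
Import ComplexField.Normc.

Local Open Scope classical_set_scope.
Local Open Scope ring_scope.

(* Sequences are indexed from 0: [lam n] and [a n] stand for lambda_(n+1) and
   a_(n+1). *)
Definition frequency (R : realType) (lam : nat -> R) : Prop :=
  [/\ forall n, 0 <= lam n,
      forall m n, (m < n)%N -> lam m < lam n &
      lam n @[n --> \oo] --> +oo].

Definition expi (R : realType) (x : R) : R[i] := Complex (cos x) (sin x).

(* A Dirichlet polynomial is a finitely supported coefficient sequence; it is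
   encoded by D : {poly R[i]}, where the coefficient D`_n multiplies
   e^(- lam n s).  Only the additive structure of {poly R[i]} is relevant. *)
Definition dirichlet_vertical (R : realType) (lam : nat -> R)
    (D : {poly R[i]}) (t : R) : R[i] :=
  \sum_(n < size D) D`_n * expi (- (lam n * t)).

Definition dirichlet_norm (R : realType) (lam : nat -> R) (p : R)
    (D : {poly R[i]}) : R :=
  lim (((2 * T)^-1 *
        \int[lebesgue_measure]_(t in `[- T, T])
          (normc (dirichlet_vertical lam D t) `^ p)) `^ p^-1 @[T --> +oo]).

Definition dirichlet_cauchy (R : realType) (lam : nat -> R) (p : R)
    (D : nat -> {poly R[i]}) : Prop :=
  forall e : R, 0 < e -> exists N : nat, forall j k : nat,
    (N <= j)%N -> (N <= k)%N -> dirichlet_norm lam p (D j - D k) < e.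

(* D represents an element of the completion whose formal Dirichlet series has
   coefficients a: the continuous extension of a coefficient functional to the
   completion is the limit of the coefficients along a Cauchy sequence. *)
Definition represents (R : realType) (lam : nat -> R) (p : R)
    (D : nat -> {poly R[i]}) (a : nat -> R[i]) : Prop :=
  dirichlet_cauchy lam p D /\
  forall n, normc ((D j)`_n - a n) @[j --> \oo] --> (0 : R).

(* The Hardy space, its elements being identified with formal series. *)
Definition hardy (R : realType) (lam : nat -> R) (p : R) : set (nat -> R[i]) :=
  [set a | exists D, represents lam p D a].

(* The norm of the completion is the limit of the norms along a representing
   Cauchy sequence.  As the map from the completion to coefficient sequences is
   injective, the set below is a singleton for a in [hardy lam p], and [inf]
   selects its element. *)
Definition hardy_norm (R : realType) (lam : nat -> R) (p : R)
    (a : nat -> R[i]) : R :=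
  inf [set r | exists D, represents lam p D a /\
                         dirichlet_norm lam p (D j) @[j --> \oo] --> r].

Definition translation (R : realType) (lam : nat -> R) (sigma : R)
    (a : nat -> R[i]) : nat -> R[i] :=
  fun n => a n * (expR (- (lam n * sigma)))%:C%C.

Definition hardy_continuous (R : realType) (lam : nat -> R) (p q : R)
    (f : (nat -> R[i]) -> (nat -> R[i])) : Prop :=
  forall a, hardy lam p a -> forall e : R, 0 < e -> exists2 d : R, 0 < d &
    forall b, hardy lam p b ->
      hardy_norm lam p (fun n => b n - a n) < d ->
      hardy_norm lam q (fun n => f b n - f a n) < e.

Definition hypercontractive (R : realType) (lam : nat -> R) : Prop :=
  forall p q sigma : R, 1 <= p -> p < q -> 0 < sigma ->
    (forall a, hardy lam p a -> hardy lam q (translation lam sigma a)) /\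
    hardy_continuous lam p q (translation lam sigma).

Definition sum_repr (R : realType) (lam : nat -> R) (k : nat) (mu : R) :
    set (k.-tuple nat) :=
  [set n | \sum_(i < k) lam (tnth n i) = mu].
Arguments sum_repr {R} lam k mu.

(* For a frequency, [sum_repr lam k mu] is always finite. *)
Definition sum_repr_count (R : realType) (lam : nat -> R) (k : nat) (mu : R) :
    nat :=
  #|` fset_set (sum_repr lam k mu)|%fset.

(* Main.v *)
(** Two estimates for Dirichlet polynomials [D] with coefficients [a_n] give the
    theorem.

    Expanding [|D|^(2k)] and grouping the products of coefficients by the value
    of [lam n_1 + ... + lam n_k], the counting hypothesis yields
    [||tau_s D||_(2k) <= C ||D||_2] for all [k] and [s > 0].

    The passage from [H_1] to [H_2] localizes [D] in frequency.  Let [D_j] have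
    coefficients [a_n K(lam n - j)], with [K] a Gaussian-like bump that is a
    power of a cosine: [D_j] is an average of vertical translates of [D], so
    [||D_j||_1 <= ||D||_1].  With [B = ||tau_s D||_2] the first estimate gives
    [||D_j||_4 <= C exp(5 s j / 4) B], and [x^2 <= A x + A^-2 x^4] gives
    [||D_j||_2^2 <= A_j ||D||_1 + A_j^-2 ||D_j||_4^4] for every [A_j > 0].  With
    [A_j = A exp(7 s j / 4)], summing over [j] with weights [exp(-2 s j)] yields
    [B^2 <= C A ||D||_1 + C A^-2 B^4], and [A] proportional to [B] gives
    [B <= C ||D||_1].

    The means exist because [|D|^p] is a uniform limit of trigonometric
    polynomials: approximate [x^(p/2)] by polynomials and substitute [|D|^2]. *)
Require Import Defs.
From mathcomp Require Import all_boot all_order all_algebra.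
From mathcomp Require Import all_classical all_reals all_analysis.
From mathcomp Require Import finmap complex.
From mathcomp Require Import ring lra.

Set Implicit Arguments.
Unset Strict Implicit.
Unset Printing Implicit Defensive.

Import Order.TTheory GRing.Theory Num.Theory.
Import numFieldNormedType.Exports.
Import ComplexField.Normc.

Local Open Scope classical_set_scope.
Local Open Scope ring_scope.

Local Notation Re := complex.Re.
Local Notation Im := complex.Im.

(** * Trigonometric polynomials and their averages *)

Section ExponentialSums.
Context {R : realType}.
Local Notation C := R[i].
Local Notation mu := (@lebesgue_measure R).
Implicit Types (f g : R -> R) (z w c : C) (x t e h T : R).

Lemma ReD z w : Re (z + w) = Re z + Re w.
Proof. by case: z w => a b [a1 b1]; reflexivity. Qed.

Lemma ImD z w : Im (z + w) = Im z + Im w.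
Proof. by case: z w => a b [a1 b1]; reflexivity. Qed.

Lemma ReM z w : Re (z * w) = Re z * Re w - Im z * Im w.
Proof. by case: z w => a b [a1 b1]; reflexivity. Qed.

Lemma ImM z w : Im (z * w) = Re z * Im w + Im z * Re w.
Proof. by case: z w => a b [a1 b1]; reflexivity. Qed.

Lemma ReJ z : Re (z^*)%C = Re z.
Proof. by case: z. Qed.

Lemma ImJ z : Im (z^*)%C = - Im z.
Proof. by case: z. Qed.

Lemma eqC z w : Re z = Re w -> Im z = Im w -> z = w.
Proof. by case: z w => a b [a' b'] /= -> ->. Qed.

Lemma sqr_normc z : normc z ^+ 2 = Re z ^+ 2 + Im z ^+ 2.
Proof. by case: z => a b; rewrite /normc sqr_sqrtr// addr_ge0 ?sqr_ge0. Qed.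

Lemma sqr_normcJ z : normc z ^+ 2 = Re (z * (z^*)%C).
Proof. by rewrite sqr_normc ReM ReJ ImJ; ring. Qed.

Lemma normc_ge0 z : 0 <= normc z.
Proof. by case: z => a b; rewrite /normc sqrtr_ge0. Qed.

Lemma normcR x : normc x%:C%C = `|x|.
Proof. by rewrite /= expr0n addr0 sqrtr_sqr. Qed.

Lemma Re_le_normc z : `|Re z| <= normc z.
Proof.
by case: z => a b; rewrite /= -sqrtr_sqr ler_sqrt ?addr_ge0 ?sqr_ge0// lerDl sqr_ge0.
Qed.

Lemma expiD x t : expi (x + t) = expi x * expi t.
Proof.
by apply: eqC; rewrite ?ReM ?ImM /= ?cosD ?sinD// addrC.
Qed.

Lemma expi0 : expi (0 : R) = 1.
Proof. by apply: eqC; rewrite /= ?cos0 ?sin0. Qed.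

Lemma expiN x : expi (- x) = ((expi x)^*)%C.
Proof. by apply: eqC; rewrite /= ?cosN ?sinN. Qed.

Lemma normc_expi x : normc (expi x) = 1.
Proof. by rewrite /= cos2Dsin2 sqrtr1. Qed.

(** Real trigonometric polynomials with arbitrary real frequencies. The inductive form lets linear
    facts be checked on single exponentials. *)
Inductive trig : (R -> R) -> Prop :=
| trig_expi c x : trig (fun t => Re (c * expi (x * t)))
| trig_add f g : trig f -> trig g -> trig (fun t => f t + g t).

Lemma eq_trig f g : f =1 g -> trig f -> trig g.
Proof. by move=> /funext ->. Qed.

Lemma trig_cst x : trig (fun=> x).
Proof.
apply: eq_trig (trig_expi x%:C%C 0) => t.
by rewrite mul0r expi0 mulr1.
Qed.

Lemma trigZ x f : trig f -> trig (fun t => x * f t).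
Proof.
elim=> [c y|f1 f2 _ t1 _ t2].
  by apply: eq_trig (trig_expi (x%:C%C * c) y) => t; rewrite !ReM !ImM /=; ring.
by apply: eq_trig (trig_add t1 t2) => t; rewrite mulrDr.
Qed.

Lemma trigM f g : trig f -> trig g -> trig (fun t => f t * g t).
Proof.
move=> tf tg; elim: tf => [c x|f1 f2 _ t1 _ t2]; last first.
  by apply: eq_trig (trig_add t1 t2) => t; rewrite mulrDl.
elim: tg => [d y|g1 g2 _ t1 _ t2]; last first.
  by apply: eq_trig (trig_add t1 t2) => t; rewrite mulrDr.
have := trig_add (trigZ 2^-1 (trig_expi (c * d) (x + y)))
                 (trigZ 2^-1 (trig_expi (c * (d^*)%C) (x - y))).
apply: eq_trig => t.
rewrite mulrBl mulrDl !expiD expiN !ReM !ImM !ReJ !ImJ ?ReM ?ImM.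
by field.
Qed.

Lemma trig_bounded f : trig f -> exists K, forall t, `|f t| <= K.
Proof.
elim=> [c x|f1 f2 _ [K1 h1] _ [K2 h2]].
  exists (normc c) => t; apply: le_trans (Re_le_normc _) _.
  by rewrite normcM normc_expi mulr1.
by exists (K1 + K2) => t; apply: le_trans (ler_normD _ _) (lerD _ _).
Qed.

Lemma trig_continuous f : trig f -> continuous f.
Proof.
elim=> [c x|f1 f2 _ h1 _ h2]; last first.
  by move=> t; apply: continuousD; [exact: h1|exact: h2].
have -> : (fun t => Re (c * expi (x * t))) =
    (fun t => Re c * cos (x * t) - Im c * sin (x * t)).
  by apply/funext => t; rewrite ReM.
have cx : continuous (fun t : R => x * t).
  by move=> t; apply: continuousM; [exact: cvg_cst|exact: cvg_id].
have cc (phi : R -> R) : continuous phi -> continuous (fun t => phi (x * t)).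
  move=> cphi t.
  by apply: (@continuous_comp _ _ _ ( *%R x) phi); [exact: cx|exact: cphi].
move=> t; apply: cvgB; apply: cvgM; try exact: cvg_cst.
  exact: (cc _ (@continuous_cos R)).
exact: (cc _ (@continuous_sin R)).
Qed.

Definition avg T f : R := (2 * T)^-1 * \int[mu]_(t in `[- T, T]) f t.

Lemma integrable_itv f T : continuous f ->
  mu.-integrable `[- T, T] (EFin \o f).
Proof.
move=> cf; apply: continuous_compact_integrable; first exact: segment_compact.
exact: continuous_subspaceT.
Qed.

Lemma avgD f g T : continuous f -> continuous g ->
  avg T (fun t => f t + g t) = avg T f + avg T g.
Proof.
move=> cf cg; rewrite /avg RintegralD ?mulrDr//; exact: integrable_itv.
Qed.

Lemma avgZ x f T : continuous f -> avg T (fun t => x * f t) = x * avg T f.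
Proof.
move=> cf; rewrite /avg RintegralZl//; last exact: integrable_itv.
by rewrite mulrCA.
Qed.

Lemma avg_cst x T : 0 < T -> avg T (fun=> x) = x.
Proof.
move=> T0; rewrite /avg Rintegral_cst//.
have -> : fine (mu `[- T, T]) = 2 * T.
  have := lebesgue_measure_itv `[- T, T].
  rewrite /= lte_fin gtrN// => ->.
  by rewrite /= opprK mulr_natl mulr2n.
by rewrite mulrCA mulVf ?mulr1// mulf_neq0// gt_eqF.
Qed.

Lemma le_avg f g T : 0 < T -> continuous f -> continuous g ->
  (forall t, f t <= g t) -> avg T f <= avg T g.
Proof.
move=> T0 cf cg fg; rewrite /avg ler_pM2l ?invr_gt0 ?mulr_gt0//.
by apply: le_Rintegral => //; exact: integrable_itv.
Qed.

(** For [x != 0] the integrand has a bounded antiderivative, so its integral over [[- T, T]] stays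
    bounded while the divisor [2 * T] grows. *)
Lemma avg_expi c x : avg T (fun t => Re (c * expi (x * t))) @[T --> +oo] -->
  (if x == 0 then Re c else 0).
Proof.
case: eqVneq => [->|x0].
  apply: cvg_near_cst.
  near=> T.
  rewrite (_ : (fun t => _) = fun=> Re c) ?avg_cst//.
  by apply/funext => t; rewrite mul0r expi0 mulr1.
pose F t := x^-1 * (Re c * sin (x * t) + Im c * cos (x * t)).
have dF t : is_derive t 1 F (Re (c * expi (x * t))).
  rewrite /F; apply: is_derive_eq; rewrite ReM /= /GRing.scale /=.
  by field.
have intE T : 0 < T ->
    \int[mu]_(t in `[- T, T]) Re (c * expi (x * t)) = F T - F (- T).
  move=> T0; rewrite /Rintegral (@continuous_FTC2 _ _ F) ?gtrN//.
  - by apply/continuous_subspaceT/trig_continuous/trig_expi.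
  - have cF : continuous F.
      move=> t; apply/differentiable_continuous/derivable1_diffP.
      exact: ex_derive.
    split; first by move=> t _; exact: ex_derive.
      exact/cvg_at_right_filter/cF.
    exact/cvg_at_left_filter/cF.
  - by move=> t _; rewrite derive1E; exact: derive_val.
pose K := `|x|^-1 * (`|Re c| + `|Im c|).
have FK t : `|F t| <= K.
  rewrite /F /K normrM normfV ler_pM2l ?invr_gt0 ?normr_gt0//.
  apply: le_trans (ler_normD _ _) _; rewrite !normrM.
  by apply: lerD; rewrite ler_piMr// ?cos_max ?sin_max.
have K0 : 0 <= K by rewrite mulr_ge0// ?addr_ge0.
apply/cvgrPdist_le => e e0; near=> T.
have T0 : 0 < T by near: T; exact: nbhs_pinfty_gt.
rewrite sub0r normrN /avg intE// normrM normfV.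
rewrite (@ger0_norm _ (2 * T)) ?mulr_ge0 ?(ltW T0)//.
rewrite [leLHS]mulrC ler_pdivrMr ?mulr_gt0//.
apply: le_trans (ler_normB _ _) _.
apply: (@le_trans _ _ (K + K)); first exact: lerD.
have : K / e <= T by near: T; apply: nbhs_pinfty_ge; exact: num_real.
by rewrite ler_pdivrMr//; nra.
Unshelve. all: by end_near.
Qed.
End ExponentialSums.

(** * Means of almost periodic functions *)

Section AlmostPeriodic.
Context {R : realType}.
Local Notation C := R[i].
Implicit Types (f g : R -> R) (x t e h T : R).

(** Uniform limits of trigonometric polynomials, that is, the real almost periodic functions of
    Bohr. *)
Definition ap f := forall e, 0 < e ->
  exists2 g, trig g & forall t, `|f t - g t| <= e.

Lemma trig_ap f : trig f -> ap f.
Proof.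
by move=> tf e e0; exists f => // t; rewrite subrr normr0 ltW.
Qed.

Lemma eq_ap f g : f =1 g -> ap f -> ap g.
Proof. by move=> /funext ->. Qed.

Lemma apD f g : ap f -> ap g -> ap (fun t => f t + g t).
Proof.
move=> af ag e e0; have e2 : 0 < e / 2 by rewrite divr_gt0.
have [f1 tf1 h1] := af _ e2; have [g1 tg1 h2] := ag _ e2.
exists (fun t => f1 t + g1 t); first exact: trig_add.
move=> t; rewrite opprD addrACA [leRHS]splitr.
exact: le_trans (ler_normD _ _) (lerD (h1 t) (h2 t)).
Qed.

Lemma ap_bounded f : ap f -> exists K, forall t, `|f t| <= K.
Proof.
move=> af; have [g tg h] := af 1 ltr01; have [K hK] := trig_bounded tg.
exists (1 + K) => t; rewrite -(subrK (g t) (f t)).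
exact: le_trans (ler_normD _ _) (lerD (h t) (hK t)).
Qed.

Lemma apM f g : ap f -> ap g -> ap (fun t => f t * g t).
Proof.
move=> af ag.
have [Kf hf] := ap_bounded af; have [Kg hg] := ap_bounded ag.
have Kf0 : 0 <= Kf := le_trans (normr_ge0 _) (hf 0).
have Kg0 : 0 <= Kg := le_trans (normr_ge0 _) (hg 0).
(* The bound [d <= 1] keeps the approximant of [g] below [Kg + 1]; the two error terms then add up
   to at most [d * (Kf + Kg + 1)]. *)
move=> e e0; pose d := Num.min 1 (e / (Kf + Kg + 1)).
have K0 : 0 < Kf + Kg + 1 by lra.
have d0 : 0 < d by rewrite lt_min ltr01 divr_gt0.
have d1 : d <= 1 by rewrite ge_min lexx.
have de : d * (Kf + Kg + 1) <= e.
  by rewrite -ler_pdivlMr// ge_min lexx orbT.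
have [f1 tf1 h1] := af _ d0; have [g1 tg1 h2] := ag _ d0.
exists (fun t => f1 t * g1 t); first exact: trigM.
move=> t.
have -> : f t * g t - f1 t * g1 t = (f t - f1 t) * g1 t + f t * (g t - g1 t).
  by ring.
apply: le_trans (ler_normD _ _) _; rewrite !normrM.
have g1K : `|g1 t| <= Kg + 1.
  rewrite -(subrK (g t) (g1 t)) [leRHS]addrC.
  apply: le_trans (ler_normD _ _) (lerD _ (hg t)).
  by rewrite distrC (le_trans (h2 t)).
apply: le_trans de.
apply: (@le_trans _ _ (d * (Kg + 1) + Kf * d)); last lra.
by apply: lerD; apply: ler_pM.
Qed.

Lemma ap_cst x : ap (fun=> x).
Proof. exact/trig_ap/trig_cst. Qed.

Lemma apZ x f : ap f -> ap (fun t => x * f t).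
Proof. exact/apM/ap_cst. Qed.

Lemma apB f g : ap f -> ap g -> ap (fun t => f t - g t).
Proof.
move=> af ag; apply: eq_ap (apD af (apZ (-1) ag)) => t.
by rewrite mulN1r.
Qed.

Lemma apX f n : ap f -> ap (fun t => f t ^+ n).
Proof.
move=> af; elim: n => [|n IH]; first exact: ap_cst.
by apply: eq_ap (apM af IH) => t; rewrite exprS.
Qed.

Lemma ap_sum (I : Type) (s : seq I) (P : pred I) (F : I -> R -> R) :
  (forall i, ap (F i)) -> ap (fun t => \sum_(i <- s | P i) F i t).
Proof.
move=> tF; elim: s => [|i s IH].
  by apply: eq_ap (ap_cst 0) => t; rewrite big_nil.
have [Pi|nPi] := boolP (P i).
  by apply: eq_ap (apD (tF i) IH) => t; rewrite big_cons Pi.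
by apply: eq_ap IH => t; rewrite big_cons (negbTE nPi).
Qed.

Lemma ap_closed f :
  (forall e, 0 < e -> exists2 g, ap g & forall t, `|f t - g t| <= e) -> ap f.
Proof.
move=> af e e0; have e2 : 0 < e / 2 by rewrite divr_gt0.
have [g ag h1] := af _ e2; have [g1 tg1 h2] := ag _ e2.
exists g1 => // t; rewrite [leRHS]splitr.
exact: le_trans (ler_distD (g t) _ _) (lerD (h1 t) (h2 t)).
Qed.

Lemma ap_continuous f : ap f -> continuous f.
Proof.
move=> af t; apply/cvgrPdist_le => /= e e0.
have e3 : 0 < e / 3 by rewrite divr_gt0.
have [g tg h] := af _ e3.
have /cvgrPdist_le/(_ _ e3) := trig_continuous tg (x := t).
apply: filterS => s gs.
have -> : f t - f s = (f t - g t) + (g t - g s) + (g s - f s) by ring.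
apply: le_trans (ler_normD _ _) _.
apply: (@le_trans _ _ (e / 3 + e / 3 + e / 3)); last by lra.
apply: lerD; last by rewrite distrC.
by apply: le_trans (ler_normD _ _) _; apply: lerD.
Qed.

Definition mean f : R := lim (avg T f @[T --> +oo]).

Lemma trig_cvg f : trig f -> cvg (avg T f @[T --> +oo]).
Proof.
elim=> [c x|f1 f2 t1 c1 t2 c2].
  by apply/cvg_ex; eexists; exact: avg_expi.
rewrite (_ : (fun T => _) = (fun T => avg T f1 + avg T f2)); last first.
  by apply/funext => T; rewrite avgD//; exact: trig_continuous.
exact: is_cvgD.
Qed.

Lemma avg_dist f g e T : 0 < T -> continuous f -> continuous g ->
  (forall t, `|f t - g t| <= e) -> `|avg T f - avg T g| <= e.
Proof.
move=> T0 cf cg fg; rewrite ler_distl; apply/andP; split.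
  rewrite lerBlDr -[X in _ + X](avg_cst e T0) -avgD//; last first.
    by move=> ?; exact: cvg_cst.
  apply: le_avg => //.
    by move=> x; apply: continuousD; [exact: cf|exact: cvg_cst].
  by move=> t; have := fg t; rewrite ler_distl lerBlDr => /andP[].
rewrite -[X in _ + X](avg_cst e T0) -avgD//; last by move=> ?; exact: cvg_cst.
apply: le_avg => //.
  by move=> x; apply: continuousD; [exact: cg|exact: cvg_cst].
by move=> t; have := fg t; rewrite ler_distl => /andP[].
Qed.

(** A trigonometric approximant has convergent averages, and the averages of [f] stay uniformly
    close to them, so they satisfy the Cauchy criterion. *)
Lemma ap_cvg f : ap f -> cvg (avg T f @[T --> +oo]).
Proof.
move=> af; apply/cauchy_cvgP/cauchy_exP => _/posnumP[e].
have e2 : 0 < e%:num / 3 by rewrite divr_gt0.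
have [g tg h] := af _ e2.
exists (mean g).
suff : \forall T \near +oo, ball (mean g) e%:num (avg T f) by [].
near=> T.
rewrite -ball_normE /=.
have T0 : 0 < T by near: T; apply: nbhs_pinfty_gt; exact: num_real.
apply: (@le_lt_trans _ _ (e%:num / 3 + e%:num / 3)); last first.
  by have : 0 < e%:num by []; lra.
apply: le_trans (ler_distD (avg T g) _ _) _.
apply: lerD.
  near: T; by have /cvgrPdist_le := trig_cvg tg; apply.
rewrite distrC; apply: avg_dist => //; first exact: ap_continuous.
exact: trig_continuous.
Unshelve. all: by end_near.
Qed.

Lemma mean_cvg f : ap f -> avg T f @[T --> +oo] --> mean f.
Proof. exact: ap_cvg. Qed.

Lemma mean_eq f x : avg T f @[T --> +oo] --> x -> mean f = x.
Proof. exact: cvg_lim. Qed.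

Lemma meanD f g : ap f -> ap g -> mean (fun t => f t + g t) = mean f + mean g.
Proof.
move=> af ag; apply: mean_eq.
rewrite (_ : (fun T => _) = (fun T => avg T f + avg T g)); last first.
  by apply/funext => T; rewrite avgD//; exact: ap_continuous.
by apply: cvgD; exact: mean_cvg.
Qed.

Lemma meanZ x f : ap f -> mean (fun t => x * f t) = x * mean f.
Proof.
move=> af; apply: mean_eq.
rewrite (_ : (fun T => _) = (fun T => x * avg T f)); last first.
  by apply/funext => T; rewrite avgZ//; exact: ap_continuous.
by apply: cvgM; [exact: cvg_cst|exact: mean_cvg].
Qed.

Lemma mean_cst x : mean (fun=> x) = x.
Proof.
apply: mean_eq; apply: cvg_near_cst.
by near=> T; rewrite avg_cst//.
Unshelve. all: by end_near.
Qed.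

Lemma mean_expi (c : C) x :
  mean (fun t => Re (c * expi (x * t))) = if x == 0 then Re c else 0.
Proof. exact/mean_eq/avg_expi. Qed.

Lemma mean_sum (I : Type) (s : seq I) (P : pred I) (F : I -> R -> R) :
  (forall i, ap (F i)) ->
  mean (fun t => \sum_(i <- s | P i) F i t) = \sum_(i <- s | P i) mean (F i).
Proof.
move=> tF; elim: s => [|i s IH].
  rewrite big_nil -[RHS](mean_cst 0); congr mean; apply/funext => t.
  by rewrite big_nil.
rewrite big_cons; have [Pi|nPi] := boolP (P i); rewrite -IH.
  rewrite -meanD//; last exact: ap_sum.
  by congr mean; apply/funext => t; rewrite big_cons Pi.
by congr mean; apply/funext => t; rewrite big_cons (negbTE nPi).
Qed.

Lemma le_mean f g : ap f -> ap g -> (forall t, f t <= g t) -> mean f <= mean g.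
Proof.
move=> af ag fg; apply: ler_lim; [exact: ap_cvg|exact: ap_cvg|].
near=> T; apply: le_avg => //; first exact: ap_continuous.
exact: ap_continuous.
Unshelve. all: by end_near.
Qed.

Lemma mean_ge0 f : ap f -> (forall t, 0 <= f t) -> 0 <= mean f.
Proof. by move=> af f0; rewrite -(mean_cst 0) le_mean//; exact: ap_cst. Qed.

(** A shift multiplies the coefficient at frequency [x] by the phase [expi (x * h)], which is 1 at
    [x = 0], the only frequency that the mean sees. *)
Lemma trig_shift f h : trig f ->
  trig (fun t => f (t + h)) /\ mean (fun t => f (t + h)) = mean f.
Proof.
elim=> [c x|f1 f2 t1 [s1 m1] t2 [s2 m2]]; last first.
  by split; [exact: trig_add|rewrite !meanD ?m1 ?m2//; exact: trig_ap].
have E : (fun t => Re (c * expi (x * t) * expi (x * h))) =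
         (fun t => Re (c * expi (x * (t + h)))).
  by apply/funext => t; rewrite mulrDr expiD mulrA.
have E' : (fun t => Re (c * expi (x * t) * expi (x * h))) =
         (fun t => Re (c * expi (x * h) * expi (x * t))).
  by apply/funext => t; rewrite mulrAC.
split; rewrite -E E'; first exact: trig_expi.
by rewrite !mean_expi; case: eqVneq => // ->; rewrite mul0r expi0 mulr1.
Qed.

Lemma ap_shift f h : ap f -> ap (fun t => f (t + h)).
Proof.
move=> af e e0; have [g tg hg] := af _ e0.
by exists (fun t => g (t + h)); [have [] := trig_shift h tg|].
Qed.

Lemma mean_dist f g e : ap f -> ap g -> (forall t, `|f t - g t| <= e) ->
  `|mean f - mean g| <= e.
Proof.
move=> af ag fg; rewrite ler_distl; apply/andP; split.
  rewrite lerBlDr -(mean_cst e) -meanD//; last exact: ap_cst.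
  apply: le_mean => //; first exact/apD/ap_cst.
  by move=> t; have := fg t; rewrite ler_distl lerBlDr => /andP[].
rewrite -(mean_cst e) -meanD//; last exact: ap_cst.
apply: le_mean => //; first exact/apD/ap_cst.
by move=> t; have := fg t; rewrite ler_distl => /andP[].
Qed.

Lemma mean_shift f h : ap f -> mean (fun t => f (t + h)) = mean f.
Proof.
move=> af; apply/eqP; rewrite -subr_eq0 -normr_le0; apply/ler_addgt0Pr => e e0.
have e2 : 0 < e / 2 by rewrite divr_gt0.
have [g tg hg] := af _ e2; have [th mh] := trig_shift h tg.
rewrite add0r [leRHS]splitr; apply: le_trans (ler_distD (mean g) _ _) _.
apply: lerD; last by rewrite distrC; apply: mean_dist => //; exact: trig_ap.
by rewrite -mh; apply: mean_dist => //; [exact: ap_shift|exact: trig_ap].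
Qed.

End AlmostPeriodic.

(** * Powers of almost periodic functions *)

Section Powers.
Context {R : realType}.
Implicit Types (f : R -> R) (g : nat -> R) (a e m p r s t u v x y K : R).

(* The Bernstein operator, by recursion on the number of Bernoulli(x) trials:
   [bernstein n g x] is the expectation of [g] at the number of successes. *)
Fixpoint bernstein n g x : R :=
  if n is n'.+1 then
    x * bernstein n' (fun k => g k.+1) x + (1 - x) * bernstein n' g x
  else g 0%N.

Lemma bernsteinD n g1 g2 x :
  bernstein n (fun k => g1 k + g2 k) x = bernstein n g1 x + bernstein n g2 x.
Proof. by elim: n g1 g2 => //= n IH g1 g2; rewrite !IH; ring. Qed.

Lemma bernsteinZ n a g x :
  bernstein n (fun k => a * g k) x = a * bernstein n g x.
Proof. by elim: n g => //= n IH g; rewrite !IH; ring. Qed.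

Lemma bernstein_cst n a x : bernstein n (fun=> a) x = a.
Proof. by elim: n => //= n ->; ring. Qed.

Lemma le_bernstein n g1 g2 x : 0 <= x <= 1 -> (forall k, g1 k <= g2 k) ->
  bernstein n g1 x <= bernstein n g2 x.
Proof.
case/andP=> x0 x1; elim: n g1 g2 => //= n IH g1 g2 g12.
by apply: lerD; apply: ler_wpM2l; rewrite ?subr_ge0// IH.
Qed.

(** Second moment of a binomial variable about [a]: variance plus squared bias. In the induction a
    success moves [a] to [a - 1]. *)
Lemma bernstein_var n a x :
  bernstein n (fun k => (k%:R - a) ^+ 2) x =
  n%:R * x * (1 - x) + (n%:R * x - a) ^+ 2.
Proof.
elim: n a => [|n IH] a /=; first by ring.
have -> : (fun k => (k.+1%:R - a) ^+ 2) = (fun k => (k%:R - (a - 1)) ^+ 2 : R).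
  by apply/funext => k; rewrite -natr1; ring.
by rewrite !IH -natr1; ring.
Qed.

(** Chebyshev's argument for Bernstein polynomials: a quadratic modulus of continuity at [x] is
    averaged, and the success frequency has variance at most [1 / n]. *)
Lemma bernstein_dist phi n e K x : (0 < n)%N -> 0 <= K -> 0 <= x <= 1 ->
  (forall y, 0 <= y -> `|phi y - phi x| <= e + K * (y - x) ^+ 2) ->
  `|bernstein n (fun k => phi (k%:R / n%:R)) x - phi x| <= e + K / n%:R.
Proof.
move=> n0 K0 x01 phix.
have nR : 0 < n%:R :> R by rewrite ltr0n.
have bound : bernstein n (fun k => e + K * (k%:R / n%:R - x) ^+ 2) x <= e + K / n%:R.
  rewrite bernsteinD bernstein_cst bernsteinZ lerD2l ler_wpM2l//.
  have -> : (fun k => (k%:R / n%:R - x) ^+ 2) =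
            (fun k => n%:R ^- 2 * (k%:R - n%:R * x) ^+ 2).
    by apply/funext => k; field; rewrite gt_eqF.
  rewrite bernsteinZ bernstein_var subrr expr0n addr0.
  have -> : n%:R ^- 2 * (n%:R * x * (1 - x)) = x * (1 - x) / n%:R.
    by field; rewrite gt_eqF.
  rewrite -[leRHS]mul1r ler_pM2r ?invr_gt0//.
  by case/andP: x01; nra.
rewrite -[X in _ - X](bernstein_cst n _ x) -mulN1r -bernsteinZ -bernsteinD.
rewrite ler_norml; apply/andP; split.
  rewrite lerNl -[leLHS]mulN1r -bernsteinZ; apply: le_trans bound.
  apply: le_bernstein => // k.
  have := phix (k%:R / n%:R) (divr_ge0 (ler0n _ _) (ler0n _ _)).
  by rewrite ler_norml => /andP[]; lra.
apply: le_trans bound; apply: le_bernstein => // k.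
have := phix (k%:R / n%:R) (divr_ge0 (ler0n _ _) (ler0n _ _)).
by rewrite ler_norml => /andP[]; lra.
Qed.

Lemma ap_bernstein n g f : ap f -> ap (fun t => bernstein n g (f t)).
Proof.
move=> af; elim: n g => [|n IH] g /=; first exact: ap_cst.
by apply: apD; apply: apM => //; apply: apB => //; exact: ap_cst.
Qed.

(** A ratio [w / (u + v)] in [0, 1] is at most its [r]-th power; add this for [w = u] and
    [w = v]. *)
Lemma powR_subadditive u v r : 0 <= u -> 0 <= v -> 0 < r <= 1 ->
  (u + v) `^ r <= u `^ r + v `^ r.
Proof.
move=> u0 v0 /andP[r0 r1].
have [->|uv0] := eqVneq (u + v) 0.
  by rewrite powR0 ?gt_eqF// addr_ge0 ?powR_ge0.
have s0 : 0 < u + v by rewrite lt_neqAle eq_sym uv0 addr_ge0.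
have H w : 0 <= w -> w <= u + v -> (u + v) `^ r * (w / (u + v)) <= w `^ r.
  move=> w0 ws; have [->|wn0] := eqVneq w 0.
    by rewrite mul0r mulr0 powR_ge0.
  have wp : 0 < w by rewrite lt_neqAle eq_sym wn0.
  have {2}-> : w = (u + v) * (w / (u + v)) by field; rewrite gt_eqF.
  rewrite [leRHS]powRM ?divr_ge0 ?(ltW s0)//.
  rewrite ler_wpM2l ?powR_ge0// ger1_powR// divr_gt0//=.
  by rewrite ler_pdivrMr// mul1r.
have := lerD (H u u0 _) (H v v0 _); rewrite lerDl lerDr => /(_ v0 u0).
by rewrite -mulrDr -mulrDl divff ?mulr1.
Qed.

Lemma powR_dist u v r : 0 <= u -> 0 <= v -> 0 < r <= 1 ->
  `|u `^ r - v `^ r| <= `|u - v| `^ r.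
Proof.
move=> u0 v0 r01; wlog uv : u v u0 v0 / v <= u.
  move=> H; have /orP[vu|uv] := le_total v u; first exact: H.
  by rewrite distrC (distrC u) H.
have r0 : 0 <= r by case/andP: r01 => /ltW.
rewrite !ger0_norm ?subr_ge0//; last by rewrite ge0_ler_powR.
rewrite lerBlDr -{1}(subrK v u); apply: powR_subadditive => //.
by rewrite subr_ge0.
Qed.

Lemma powR_quadratic u r e : 0 <= u -> 0 < r -> 0 < e -> u <= 1 ->
  u `^ r <= e + (e `^ r^-1) ^- 2 * u ^+ 2.
Proof.
move=> u0 r0 e0 u1.
have d0 : 0 < e `^ r^-1 by rewrite powR_gt0.
have [ue|eu] := leP u (e `^ r^-1).
  apply: (@le_trans _ _ e); last first.
    by rewrite lerDl mulr_ge0// ?invr_ge0 ?exprn_ge0// ltW.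
  rewrite -[leRHS](@powRr1 _ e) ?(ltW e0)// -(mulVf (lt0r_neq0 r0)) powRrM.
  by rewrite ge0_ler_powR ?nnegrE ?(ltW r0) ?powR_ge0.
apply: (@le_trans _ _ 1).
  have E : 1 `^ r = 1 :> R by rewrite powR1.
  by rewrite -[leRHS]E ge0_ler_powR ?nnegrE ?(ltW r0).
apply: (@le_trans _ _ ((e `^ r^-1) ^- 2 * u ^+ 2)); last by rewrite lerDr ltW.
rewrite mulrC ler_pdivlMr ?exprn_gt0// mul1r.
by rewrite lerXn2r ?nnegrE ?powR_ge0 ?(ltW eu)//.
Qed.

Lemma ap_powR1 f r : ap f -> (forall t, 0 <= f t <= 1) -> 0 < r <= 1 ->
  ap (fun t => f t `^ r).
Proof.
move=> af f01 r01; have r0 : 0 < r by case/andP: r01.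
apply: ap_closed => e e0.
have e2 : 0 < e / 2 by rewrite divr_gt0.
(* The first summand serves [|y - f t| <= 1] through [powR_quadratic]. The [+ 1] serves larger
   distances, where the [r]-th power is at most the square. *)
pose K := ((e / 2) `^ r^-1) ^- 2 + 1.
have K1 : 1 <= K by rewrite lerDr invr_ge0 exprn_ge0// powR_ge0.
have K0 : 0 < K by exact: lt_le_trans K1.
pose n := (Num.truncn (K / (e / 2))).+1.
exists (fun t => bernstein n (fun k => (k%:R / n%:R) `^ r) (f t)).
  exact: ap_bernstein.
move=> t; rewrite distrC; case/andP: (f01 t) => ft0 ft1.
apply: (@le_trans _ _ (e / 2 + K / n%:R)).
  apply: (bernstein_dist (phi := fun y => y `^ r)) => //; first exact: ltW.
  move=> y y0; have [yf|yf] := leP `|y - f t| 1.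
    apply: le_trans (powR_dist y0 ft0 r01) _.
    apply: le_trans (powR_quadratic (normr_ge0 _) r0 e2 yf) _.
    rewrite lerD2l real_normK ?num_real// ler_wpM2r ?sqr_ge0//.
    by rewrite /K lerDl.
  apply: le_trans (powR_dist y0 ft0 r01) _.
  have yf' : `|y - f t| `^ r <= `|y - f t| ^+ 2.
    rewrite -powR_mulrn// ler_powR ?ltW//.
    by case/andP: r01; lra.
  apply: le_trans yf' _; rewrite real_normK ?num_real//.
  by have := sqr_ge0 (y - f t); nra.
rewrite [leRHS]splitr lerD2l ler_pdivrMr ?ltr0n// mulrC -ler_pdivrMr//.
by apply: ltW; rewrite truncnS_gt.
Qed.

(** Exponents up to 1 reduce to [ap_powR1] by scaling [f] into [0, 1]; larger ones descend through
    [f]^ r = f * f [^ (r - 1)]. *)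
Lemma ap_powR f r : ap f -> (forall t, 0 <= f t) -> 0 < r ->
  ap (fun t => f t `^ r).
Proof.
move=> af f0 r0; have [n rn] : exists n : nat, r <= n.+1%:R.
  by exists (Num.truncn r); apply: ltW; rewrite truncnS_gt.
elim: n r r0 rn => [|n IH] r r0 rn.
  have [K fK] := ap_bounded af.
  have K0 : 0 < K + 1 by have := fK 0; have := normr_ge0 (f 0); lra.
  have := apZ ((K + 1) `^ r) (@ap_powR1 (fun t => (K + 1)^-1 * f t) r _ _ _).
  move=> H; apply: eq_ap (H _ _ _).
  - move=> t; rewrite -powRM ?mulVKf ?gt_eqF ?(ltW K0)//.
    by rewrite mulr_ge0// invr_ge0 ltW.
  - exact: apZ.
  - move=> t; rewrite mulr_ge0 ?invr_ge0 ?(ltW K0)//= mulrC.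
    by rewrite ler_pdivrMr// mul1r; have := fK t; have := ler_norm (f t); lra.
  - by rewrite r0 rn.
have [r1|r1] := leP r 1.
  by apply: IH => //; apply: le_trans r1 _; rewrite ler1n.
have r1' : 0 < r - 1 by rewrite subr_gt0.
apply: eq_ap (apM af (IH (r - 1) r1' _)) => [t|].
  by rewrite mulr_powRB1.
by rewrite lerBlDr natr1.
Qed.

Lemma cvg_powR (F : set_system R) {FF : ProperFilter F} f m r :
  (\forall t \near F, 0 <= f t) -> f t @[t --> F] --> m -> 0 < r <= 1 ->
  f t `^ r @[t --> F] --> m `^ r.
Proof.
move=> f0 fm r01; have r0 : 0 < r by case/andP: r01.
have m0 : 0 <= m by rewrite -(cvg_lim _ fm)//; apply: limr_ge => //; exact: cvgP fm.
apply/cvgrPdist_lt => e e0; near=> t.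
have ft0 : 0 <= f t by near: t.
apply: le_lt_trans (powR_dist m0 ft0 r01) _.
rewrite -[ltRHS](@powRr1 _ e) ?(ltW e0)// -(mulVf (lt0r_neq0 r0)) powRrM.
rewrite gt0_ltr_powR ?nnegrE ?powR_ge0//.
near: t; move/cvgrPdist_lt: fm; apply; exact: powR_gt0.
Unshelve. all: by end_near.
Qed.

End Powers.

(** * The norms of order p *)

Section MeanNorms.
Context {R : realType}.
Local Notation C := R[i].
Implicit Types (F G : R -> C) (c : C) (a b e h p q r t x y : R).

Definition ctrig F := trig (fun t => Re (F t)) /\ trig (fun t => Im (F t)).

Lemma eq_ctrig F G : F =1 G -> ctrig F -> ctrig G.
Proof. by move=> /funext ->. Qed.

Lemma ctrig_expi c x : ctrig (fun t => c * expi (x * t)).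
Proof.
split; first exact: trig_expi.
apply: eq_trig (trig_expi (- Complex 0 1 * c) x) => t.
by rewrite !ReM !ImM /=; ring.
Qed.

Lemma ctrigD F G : ctrig F -> ctrig G -> ctrig (fun t => F t + G t).
Proof.
case=> r1 i1 [r2 i2]; split.
  by apply: eq_trig (trig_add r1 r2) => t; rewrite ReD.
by apply: eq_trig (trig_add i1 i2) => t; rewrite ImD.
Qed.

Lemma ctrigM F G : ctrig F -> ctrig G -> ctrig (fun t => F t * G t).
Proof.
case=> r1 i1 [r2 i2]; split.
  apply: eq_trig (trig_add (trigM r1 r2) (trigZ (-1) (trigM i1 i2))) => t.
  by rewrite ReM mulN1r.
apply: eq_trig (trig_add (trigM r1 i2) (trigM i1 r2)) => t.
by rewrite ImM.
Qed.

Lemma ctrig_cst c : ctrig (fun=> c).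
Proof. by split; exact: trig_cst. Qed.

Lemma ctrig_sum (I : Type) (s : seq I) (P : pred I) (F : I -> R -> C) :
  (forall i, ctrig (F i)) -> ctrig (fun t => \sum_(i <- s | P i) F i t).
Proof.
move=> tF; elim: s => [|i s IH].
  by apply: eq_ctrig (ctrig_cst 0) => t; rewrite big_nil.
have [Pi|nPi] := boolP (P i).
  by apply: eq_ctrig (ctrigD (tF i) IH) => t; rewrite big_cons Pi.
by apply: eq_ctrig IH => t; rewrite big_cons (negbTE nPi).
Qed.

Lemma ap_normc F p : ctrig F -> 0 < p -> ap (fun t => normc (F t) `^ p).
Proof.
case=> rF iF p0.
have a2 : ap (fun t => normc (F t) ^+ 2).
  apply/trig_ap; apply: eq_trig (trig_add (trigM rF rF) (trigM iF iF)) => t.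
  by rewrite sqr_normc !expr2.
have p2 : 0 < p / 2 by rewrite divr_gt0.
apply: eq_ap (ap_powR a2 _ p2) => t; last exact: sqr_ge0.
rewrite -powR_mulrn ?normc_ge0// -powRrM; congr (_ `^ _).
by field.
Qed.

Definition pmean p F : R := mean (fun t => normc (F t) `^ p).

Definition pnorm p F : R := pmean p F `^ p^-1.

Lemma pmean_ge0 F p : ctrig F -> 0 < p -> 0 <= pmean p F.
Proof.
by move=> cF p0; apply: mean_ge0 => [|t]; [exact: ap_normc|exact: powR_ge0].
Qed.

Lemma pnorm_ge0 F p : 0 <= pnorm p F.
Proof. exact: powR_ge0. Qed.

Lemma powR_pnorm F p : ctrig F -> 0 < p -> pnorm p F `^ p = pmean p F.
Proof.
move=> cF p0; rewrite /pnorm -powRrM mulVf ?gt_eqF// powRr1//.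
exact: pmean_ge0.
Qed.

Lemma powR_convex x y p a : 0 <= x -> 0 <= y -> 1 <= p -> 0 <= a <= 1 ->
  (a * x + (1 - a) * y) `^ p <= a * x `^ p + (1 - a) * y `^ p.
Proof.
move=> x0 y0 p1 /andP[a0 a1].
have := @convex_powR R p p1 (Itv01 a0 a1) x y.
have mem (z : R) : 0 <= z -> z \in (`[0, +oo[%classic : set R).
  by move=> z0; apply: mem_set; rewrite /= in_itv/= z0.
by move=> /(_ (mem _ x0) (mem _ y0)); rewrite !convRE.
Qed.

(** The graph of the power lies above its tangent at 1. This is Young's inequality for [y] and 1
    with the conjugate exponents [r] and [r / (r - 1)]. *)
Lemma powR_bernoulli y r : 0 <= y -> 1 <= r -> 1 + r * (y - 1) <= y `^ r.
Proof.
move=> y0; rewrite le_eqVlt => /predU1P[<-|r1].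
  by rewrite powRr1//; lra.
have r0 : 0 < r by lra.
have r10 : 0 < r - 1 by lra.
have E : r^-1 + (r / (r - 1))^-1 = 1.
  by field; rewrite !gt_eqF.
have := conjugate_powR y0 ler01 r0 (divr_gt0 r0 r10) E.
rewrite powR1 mulr1 invf_div mul1r => H.
have : y * r <= (y `^ r / r + (r - 1) / r) * r by rewrite ler_pM2r.
have -> : (y `^ r / r + (r - 1) / r) * r = y `^ r + r - 1.
  by field; rewrite gt_eqF.
by lra.
Qed.

(** Minkowski's inequality from convexity: [(F + G) / (a + b)] is the convex combination of [F / a]
    and [G / b] with weights [a / (a + b)] and [b / (a + b)]. *)
Lemma pnormD F G p : ctrig F -> ctrig G -> 1 <= p ->
  pnorm p (fun t => F t + G t) <= pnorm p F + pnorm p G.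
Proof.
move=> cF cG p1; have p0 : 0 < p by lra.
apply/ler_addgt0Pr => e e0.
(* The added [e / 2] makes both divisors positive even when a norm vanishes. *)
pose a := pnorm p F + e / 2; pose b := pnorm p G + e / 2.
have a0 : 0 < a by rewrite ltr_wpDl ?pnorm_ge0 ?divr_gt0.
have b0 : 0 < b by rewrite ltr_wpDl ?pnorm_ge0 ?divr_gt0.
have -> : pnorm p F + pnorm p G + e = a + b by rewrite /a /b addrACA -splitr.
have aF : pnorm p F <= a by rewrite /a lerDl ltW// divr_gt0.
have bG : pnorm p G <= b by rewrite /b lerDl ltW// divr_gt0.
clearbody a b.
pose d := a / (a + b).
have ab0 : 0 < a + b by exact: addr_gt0.
have d0 : 0 <= d by rewrite divr_ge0 ?ltW.
have d1 : d <= 1 by rewrite ler_pdivrMr// mul1r lerDl ltW.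
have da : 1 - d = b / (a + b) by rewrite /d; field; rewrite gt_eqF.
have aFp : ap (fun t => normc (F t) `^ p) by exact: ap_normc.
have aGp : ap (fun t => normc (G t) `^ p) by exact: ap_normc.
have key : pmean p (fun t => F t + G t) <= (a + b) `^ p.
  have -> : (a + b) `^ p = (a + b) `^ p * (d * 1 + (1 - d) * 1).
    by rewrite !mulr1 subrKC mulr1.
  apply: (@le_trans _ _ ((a + b) `^ p *
      (d * (a^-1 `^ p * pmean p F) + (1 - d) * (b^-1 `^ p * pmean p G)))).
    rewrite -!meanZ//; try exact: apZ.
    rewrite -meanD; try by do ?apply: apZ.
    rewrite -meanZ; last by apply: apD; do ?apply: apZ.
    apply: le_mean => [||t]; first exact: ap_normc (ctrigD cF cG) _.
      by apply/apZ/apD; do ?apply: apZ.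
    rewrite -!powRM ?normc_ge0 ?invr_ge0 ?(ltW a0) ?(ltW b0)//.
    have H := powR_convex (mulr_ge0 _ (normc_ge0 (F t)))
      (mulr_ge0 _ (normc_ge0 (G t))) p1 _.
    have {}H := H a^-1 b^-1 d.
    apply: le_trans (ler_wpM2l (powR_ge0 _ _) (H _ _ _));
      rewrite ?invr_ge0 ?(ltW a0) ?(ltW b0) ?d0//.
    rewrite -powRM ?(ltW ab0)//; last first.
      apply: addr_ge0; apply: mulr_ge0; rewrite ?subr_ge0//;
        by rewrite mulr_ge0 ?normc_ge0// invr_ge0 ltW.
    have -> : (a + b) * (d * (a^-1 * normc (F t)) + (1 - d) * (b^-1 * normc (G t)))
        = normc (F t) + normc (G t).
      by rewrite da /d; field; rewrite !gt_eqF.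
    by rewrite ge0_ler_powR ?nnegrE ?addr_ge0 ?normc_ge0 ?(ltW p0)// le_normcD.
  have H x y : 0 < x -> 0 <= y -> y <= x -> x^-1 `^ p * y `^ p <= 1.
    move=> x0 y0 yx; rewrite -powRM ?invr_ge0 ?(ltW x0)//.
    have E : 1 `^ p = 1 :> R by rewrite powR1.
    rewrite -[leRHS]E ge0_ler_powR ?nnegrE ?mulr_ge0 ?invr_ge0 ?(ltW x0) ?(ltW p0)//.
    by rewrite mulrC ler_pdivrMr// mul1r.
  rewrite ler_wpM2l ?powR_ge0// -!powR_pnorm//.
  apply: lerD; apply: ler_wpM2l; rewrite ?subr_ge0//; apply: H;
    rewrite ?pnorm_ge0//.
have pV0 : 0 <= p^-1 by rewrite invr_ge0 ltW.
have := ge0_ler_powR pV0 _ _ key; rewrite !nnegrE powR_ge0 => /(_ _ isT).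
rewrite -powRrM mulfV ?gt_eqF// powRr1 ?(ltW ab0)//; apply.
exact: pmean_ge0 (ctrigD cF cG) _.
Qed.

Lemma le_pnorm F p q : ctrig F -> 0 < p -> p <= q -> pnorm p F <= pnorm q F.
Proof.
move=> cF p0 pq; have q0 : 0 < q by exact: lt_le_trans pq.
have := pnorm_ge0 F p; rewrite le_eqVlt => /predU1P[<-|a0].
  exact: pnorm_ge0.
have := powR_pnorm cF p0; move: (pnorm p F) a0 => a a0 aE.
have aFp : ap (fun t => normc (F t) `^ p) by exact: ap_normc.
have aFq : ap (fun t => normc (F t) `^ q) by exact: ap_normc.
have ap0 : 0 < a `^ p by exact: powR_gt0.
have key : a `^ q <= pmean q F.
  have -> : a `^ q = mean (fun t =>
      a `^ q * (1 + q / p * ((a `^ p)^-1 * normc (F t) `^ p + (- 1)))).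
    rewrite meanZ; last first.
      by apply: apD (ap_cst _) _; apply: apZ; apply: apD (ap_cst _); exact: apZ.
    rewrite meanD; [|exact: ap_cst|by apply: apZ; apply: apD (ap_cst _); exact: apZ].
    rewrite meanZ; last by apply: apD (ap_cst _); exact: apZ.
    rewrite meanD; [|exact: apZ|exact: ap_cst].
    rewrite !mean_cst meanZ// -/(pmean p F) -aE mulVf ?gt_eqF//.
    by rewrite subrr mulr0 addr0 mulr1.
  apply: le_mean => //.
    apply: apZ; apply: apD (ap_cst _) _; apply: apZ.
    by apply: apD (ap_cst _); exact: apZ.
  move=> t.
  have qp1 : 1 <= q / p by rewrite ler_pdivlMr// mul1r.
  have y0 : 0 <= a^-1 * normc (F t) by rewrite mulr_ge0 ?normc_ge0// invr_ge0 ltW.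
  have := powR_bernoulli (powR_ge0 (a^-1 * normc (F t)) p) qp1.
  have pqE : p * (q / p) = q by field; rewrite gt_eqF.
  rewrite -powRrM pqE.
  rewrite !powRM ?normc_ge0 ?invr_ge0 ?(ltW a0)//.
  have E r : a^-1 `^ r = (a `^ r)^-1.
    by rewrite -powR_inv1 ?(ltW a0)// -powRrM mulN1r powRN.
  rewrite !E => H.
  have aq0 : 0 < a `^ q by exact: powR_gt0.
  by rewrite -[leRHS](mulVKf (lt0r_neq0 aq0)) ler_pM2l//.
have qV0 : 0 <= q^-1 by rewrite invr_ge0 ltW.
have := ge0_ler_powR qV0 _ _ key; rewrite !nnegrE powR_ge0 => /(_ isT).
rewrite -powRrM mulfV ?gt_eqF// powRr1 ?(ltW a0)//; apply.
exact: pmean_ge0.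
Qed.

Lemma dirichlet_vertical_ctrig lam (D : {poly C}) :
  ctrig (dirichlet_vertical lam D).
Proof.
apply: ctrig_sum => i.
by apply: eq_ctrig (ctrig_expi D`_i (- lam i)) => t; rewrite mulNr.
Qed.

(** The averages of [|D|^p] converge, and the power [p^-1 <= 1] is continuous, so the limit passes
    inside the root. *)
Lemma dirichlet_normE lam p (D : {poly C}) : 1 <= p ->
  dirichlet_norm lam p D = pnorm p (dirichlet_vertical lam D).
Proof.
move=> p1; have p0 : 0 < p by lra.
have aD := ap_normc (dirichlet_vertical_ctrig lam D) p0.
apply: (cvg_lim (@Rhausdorff R)).
apply: (@cvg_powR _ _ _
  (fun T => avg T (fun t => normc (dirichlet_vertical lam D t) `^ p))).
- near=> T; rewrite /avg mulr_ge0 ?Rintegral_ge0// => [|t _]; last exact: powR_ge0.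
  rewrite invr_ge0 mulr_ge0//; near: T; apply: nbhs_pinfty_ge; exact: num_real.
- exact: mean_cvg.
- by rewrite invr_gt0 p0 invf_le1.
Unshelve. all: by end_near.
Qed.

End MeanNorms.

(** * Orthogonality and even powers *)

Section MeanSquare.
Context {R : realType}.
Local Notation C := R[i].
Implicit Types (d t e : R).

Definition expsum (I : finType) (c : I -> C) (x : I -> R) t : C :=
  \sum_i c i * expi (x i * t).

Lemma expsum_ctrig (I : finType) (c : I -> C) (x : I -> R) : ctrig (expsum c x).
Proof. by apply: ctrig_sum => i; exact: ctrig_expi. Qed.

(** Expand the square into a double sum; the mean keeps exactly the pairs with equal frequencies. *)
Lemma mean_sqr_expsum (I : finType) (c : I -> C) (x : I -> R) :
  mean (fun t => normc (expsum c x t) ^+ 2) =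
  \sum_i \sum_(j | x j == x i) Re (c i * ((c j)^*)%C).
Proof.
have -> : (fun t => normc (expsum c x t) ^+ 2) = (fun t =>
    \sum_i \sum_j Re (c i * ((c j)^*)%C * expi ((x i - x j) * t))).
  apply/funext => t; rewrite sqr_normcJ /expsum rmorph_sum mulr_suml.
  rewrite (big_morph (fun z : C => Re z) ReD (erefl _)); apply: eq_bigr => i _.
  rewrite mulr_sumr (big_morph (fun z : C => Re z) ReD (erefl _)).
  apply: eq_bigr => j _; congr Re.
  by rewrite rmorphM /= mulrBl expiD expiN mulrACA.
rewrite mean_sum => [|i]; last first.
  by apply: ap_sum => j; apply/trig_ap/trig_expi.
apply: eq_bigr => i _; rewrite mean_sum => [|j]; last first.
  by apply/trig_ap/trig_expi.
rewrite [RHS]big_mkcond; apply: eq_bigr => j _.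
by rewrite mean_expi subr_eq0 eq_sym.
Qed.

Lemma mean_sqr_expsum_inj (I : finType) (c : I -> C) (x : I -> R) :
  injective x ->
  mean (fun t => normc (expsum c x t) ^+ 2) = \sum_i normc (c i) ^+ 2.
Proof.
move=> xi; rewrite mean_sqr_expsum; apply: eq_bigr => i _.
rewrite (big_pred1 i) => [|j]; first by rewrite sqr_normcJ.
by rewrite (inj_eq xi).
Qed.

Lemma Re_mulJ_le (z w : C) :
  Re (z * (w^*)%C) <= 2^-1 * (normc z ^+ 2 + normc w ^+ 2).
Proof.
rewrite !sqr_normc ReM ReJ ImJ.
have := sqr_ge0 (Re z - Re w); have := sqr_ge0 (Im z - Im w).
by nra.
Qed.

(** Bound each surviving cross term by half the sum of the two squares; since equality of
    frequencies is symmetric, both halves contribute the same. *)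
Lemma mean_sqr_expsum_le (I : finType) (c : I -> C) (x : I -> R) :
  mean (fun t => normc (expsum c x t) ^+ 2) <=
  \sum_i #|[pred j | x j == x i]|%:R * normc (c i) ^+ 2.
Proof.
rewrite mean_sqr_expsum.
have E : \sum_i \sum_(j | x j == x i) normc (c i) ^+ 2 =
         \sum_i #|[pred j | x j == x i]|%:R * normc (c i) ^+ 2.
  apply: eq_bigr => i _; by rewrite sumr_const mulr_natl.
have E' : \sum_i \sum_(j | x j == x i) normc (c j) ^+ 2 =
          \sum_i \sum_(j | x j == x i) normc (c i) ^+ 2.
  rewrite (exchange_big_dep predT)//=; apply: eq_bigr => i _.
  by apply: eq_bigl => j; rewrite eq_sym.
rewrite -E.
apply: (@le_trans _ _ (\sum_i \sum_(j | x j == x i)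
    2^-1 * (normc (c i) ^+ 2 + normc (c j) ^+ 2))).
  by apply: ler_sum => i _; apply: ler_sum => j _; exact: Re_mulJ_le.
under eq_bigr do rewrite -mulr_sumr big_split/=.
rewrite -mulr_sumr big_split/= E'.
by rewrite -mulr2n -[X in _ * X]mulr_natl mulKf ?pnatr_eq0.
Qed.

Definition dseries (lam : nat -> R) N (c : nat -> C) t : C :=
  \sum_(n < N) c n * expi (- (lam n * t)).

Lemma normc_translation lam d c n :
  normc (translation lam d c n) = normc (c n) * expR (- (lam n * d)).
Proof. by rewrite normcM normcR ger0_norm// expR_ge0. Qed.

Lemma dseriesE lam N c :
  dseries lam N c = expsum (fun n : 'I_N => c n) (fun n => - lam n).
Proof. by apply/funext => t; apply: eq_bigr => n _; rewrite mulNr. Qed.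

Lemma dseries_ctrig lam N c : ctrig (dseries lam N c).
Proof. by rewrite dseriesE; exact: expsum_ctrig. Qed.

Definition wt_sum (lam : nat -> R) N k (m : {ffun 'I_k -> 'I_N}) : R :=
  \sum_i lam (m i).

Lemma dseriesX lam N c k t : dseries lam N c t ^+ k =
  expsum (fun m : {ffun 'I_k -> 'I_N} => \prod_i c (m i))
         (fun m => - wt_sum lam m) t.
Proof.
rewrite -{1}(card_ord k) -prodr_const bigA_distr_bigA.
apply: eq_bigr => m _; rewrite big_split /=; congr (_ * _).
rewrite mulNr /wt_sum mulr_suml -sumrN.
by rewrite [RHS](big_morph _ (@expiD R) (@expi0 R)).
Qed.

Lemma normc_prod (I : finType) (z : I -> C) :
  normc (\prod_i z i) = \prod_i normc (z i).
Proof. exact: (big_morph _ (@normcM R) (@normc1 R)). Qed.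

(** The [k]-th power is an exponential sum over [k]-tuples. Translation by [d] gives its squared
    coefficients the factor [expR (- (2 * d * wt_sum lam m))], which cancels the growth allowed to
    the multiplicities. *)
Lemma mean_dseries_le lam N k d K (c : nat -> C) :
  (forall m : {ffun 'I_k -> 'I_N},
     #|[pred m' : {ffun 'I_k -> 'I_N} | wt_sum lam m' == wt_sum lam m]|%:R
       <= K * expR (2 * d * wt_sum lam m)) ->
  mean (fun t => normc (dseries lam N (translation lam d c) t) ^+ (2 * k)) <=
  K * (\sum_(n < N) normc (c n) ^+ 2) ^+ k.
Proof.
move=> HK.
have -> : (fun t => normc (dseries lam N (translation lam d c) t) ^+ (2 * k)) =
    (fun t => normc (expsum
      (fun m : {ffun 'I_k -> 'I_N} => \prod_i translation lam d c (m i))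
         (fun m => - wt_sum lam m) t) ^+ 2).
  apply/funext => t; rewrite mulnC exprM -dseriesX; congr (_ ^+ _).
  by elim: k {HK} => [|k IH]; rewrite ?normc1// !exprS normcM IH.
apply: le_trans (mean_sqr_expsum_le _ _) _.
rewrite -[X in _ <= _ * _ ^+ X](card_ord k) -prodr_const bigA_distr_bigA mulr_sumr.
apply: ler_sum => m _.
have -> : normc (\prod_i translation lam d c (m i)) ^+ 2 =
    expR (- (2 * d * wt_sum lam m)) * \prod_i normc (c (m i)) ^+ 2.
  rewrite normc_prod -prodrXl.
  under eq_bigr do rewrite normc_translation exprMn.
  rewrite big_split /= mulrC; congr (_ * _).
  rewrite mulr_sumr -sumrN expR_sum; apply: eq_bigr => i _.
  by rewrite -expRM_natl; congr expR; ring.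
rewrite mulrA; apply: ler_wpM2r.
  by apply: prodr_ge0 => i _; exact: sqr_ge0.
rewrite expRN ler_pdivrMr ?expR_gt0//.
apply: le_trans (HK m); rewrite ler_nat; apply: subset_leq_card.
by apply/fintype.subsetP => m'; rewrite !inE eqr_opp.
Qed.

Lemma mean_sqr_dseries lam N c : injective lam ->
  mean (fun t => normc (dseries lam N c t) ^+ 2) = \sum_(n < N) normc (c n) ^+ 2.
Proof.
move=> li; rewrite dseriesE mean_sqr_expsum_inj// => i j /oppr_inj/li.
exact: val_inj.
Qed.

End MeanSquare.

(** * Multiplicities of sums of frequencies *)

Section Counting.
Context {R : realType} (lam : nat -> R).
Hypothesis lam_freq : frequency lam.

Lemma frequency_ge0 n : 0 <= lam n.
Proof. by case: lam_freq. Qed.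

Lemma frequency_inj : injective lam.
Proof.
case: lam_freq => _ lt_lam _ m n E.
by case: (ltngtP m n) => // /lt_lam; rewrite E ltxx.
Qed.

Lemma frequency_large (x : R) : exists n0, forall n, lam n <= x -> (n < n0)%N.
Proof.
case: lam_freq => _ _ /cvgryPgt/(_ x) [n0 _ H]; exists n0 => n.
by rewrite ltnNge; apply: contraTN => /H; rewrite -ltNge.
Qed.

Lemma wt_sum_ge0 N k (m : {ffun 'I_k -> 'I_N}) : 0 <= wt_sum lam m.
Proof. by apply: sumr_ge0 => i _; exact: frequency_ge0. Qed.

Lemma wt_sum_lt N k (x : R) n0 (m : {ffun 'I_k -> 'I_N}) i :
  (forall n, lam n <= x -> (n < n0)%N) -> wt_sum lam m <= x -> (m i < n0)%N.
Proof.
move=> H mx; apply: H; apply: le_trans mx.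
rewrite /wt_sum (bigD1 i)//= lerDl sumr_ge0// => j _; exact: frequency_ge0.
Qed.

(** As the frequencies are non-negative, every entry of a tuple of weight at most [x] is below [n0].
    The bound is independent of [N]. *)
Lemma card_wt_sum_le N k (x mu : R) n0 :
  (forall n, lam n <= x -> (n < n0)%N) -> mu <= x ->
  (#|[pred m : {ffun 'I_k -> 'I_N} | wt_sum lam m == mu]| <= n0.+1 ^ k)%N.
Proof.
move=> H mux; rewrite -[X in (_ <= _ ^ X)%N](card_ord k).
rewrite -[X in (_ <= X ^ _)%N](card_ord n0.+1) -card_ffun.
pose f (m : {ffun 'I_k -> 'I_N}) : {ffun 'I_k -> 'I_n0.+1} :=
  [ffun i => inord (m i)].
rewrite -(@card_in_image _ _ f); first exact: max_card.
move=> m m'; rewrite !inE => /eqP mE /eqP m'E /ffunP E.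
apply/ffunP => i; apply: val_inj => /=.
have := congr1 val (E i); rewrite !ffunE /= !inordK//.
  by rewrite ltnS ltnW// (wt_sum_lt _ H)// m'E.
by rewrite ltnS ltnW// (wt_sum_lt _ H)// mE.
Qed.

(** Finiteness makes [fset_set] the actual set of representations instead of its default, the empty
    set. *)
Lemma finite_sum_repr k mu : finite_set (sum_repr lam k mu).
Proof.
have [n0 H] := frequency_large mu.
pose f (m : {ffun 'I_k -> 'I_n0}) : k.-tuple nat := [tuple (m i : nat) | i < k].
apply: (@sub_finite_set _ _ (range f)); last first.
  exact/finite_image/finite_finset.
move=> n /= nE.
have nlt i : (tnth n i < n0)%N.
  apply: H; rewrite -nE (bigD1 i)//= lerDl sumr_ge0// => j _.
  exact: frequency_ge0.
exists [ffun i => Ordinal (nlt i)] => //.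
by apply: eq_from_tnth => i; rewrite tnth_mktuple ffunE.
Qed.

Lemma card_wt_sum_sum_repr N k mu :
  (#|[pred m : {ffun 'I_k -> 'I_N} | wt_sum lam m == mu]|
    <= sum_repr_count lam k mu)%N.
Proof.
pose f (m : {ffun 'I_k -> 'I_N}) : k.-tuple nat := [tuple (m i : nat) | i < k].
rewrite cardE -(size_map f); apply: uniq_leq_size.
  rewrite map_inj_uniq ?enum_uniq// => m m' E.
  apply/ffunP => i; apply: val_inj => /=.
  by have := congr1 (fun n => tnth n i) E; rewrite !tnth_mktuple.
move=> n /mapP[m]; rewrite mem_enum inE => /eqP mE ->.
rewrite in_fset_set; last exact: finite_sum_repr.
apply: mem_set => /=.
by rewrite /sum_repr /= -mE; apply: eq_bigr => i _; rewrite tnth_mktuple.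
Qed.

(** For large weights the hypothesis bounds the logarithm of the count by [2 * d * mu]; for the
    others [card_wt_sum_le] gives a constant, which becomes [K]. *)
Lemma card_wt_sum_bound k (d : R) : 0 < d ->
  ln (sum_repr_count lam k mu)%:R / mu
    @[mu --> within [set mu | sum_repr lam k mu !=set0] +oo] --> (0 : R) ->
  exists2 K : R, 0 < K & forall N (m : {ffun 'I_k -> 'I_N}),
    #|[pred m' : {ffun 'I_k -> 'I_N} | wt_sum lam m' == wt_sum lam m]|%:R
      <= K * expR (2 * d * wt_sum lam m).
Proof.
move=> d0 /cvgrPdist_le/(_ (2 * d)); rewrite mulr_gt0// => /(_ isT).
rewrite near_withinE => -[x0 [_ Hx]].
(* The maximum with 1 makes large weights positive, so that the quotient by [mu] can be cleared. *)
pose x := Num.max x0 1.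
have [n0 Hn] := frequency_large x.
exists (n0.+1 ^ k)%:R; first by rewrite ltr0n expn_gt0.
move=> N m; set mu := wt_sum lam m.
have mu0 : 0 <= mu by exact: wt_sum_ge0.
have [mux|xmu] := leP mu x.
  apply: (@le_trans _ _ (n0.+1 ^ k)%:R).
    by rewrite ler_nat; exact: card_wt_sum_le Hn mux.
  by rewrite ler_peMr// -expR0 ler_expR !mulr_ge0// ltW.
move: xmu; rewrite gt_max => /andP[x0mu mu1].
have nE : sum_repr lam k mu !=set0.
  exists [tuple (m i : nat) | i < k]; rewrite /sum_repr /= /mu /wt_sum.
  by apply: eq_bigr => i _; rewrite tnth_mktuple.
have card_pos : (0 < sum_repr_count lam k mu)%N.
  apply: leq_trans (card_wt_sum_sum_repr N k mu).
  by apply/card_gt0P; exists m; rewrite inE.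
apply: (@le_trans _ _ (sum_repr_count lam k mu)%:R).
  by rewrite ler_nat; exact: card_wt_sum_sum_repr.
have mup : 0 < mu by lra.
have := Hx mu x0mu nE; rewrite sub0r normrN => /(le_trans (ler_norm _)).
rewrite ler_pdivrMr// -ler_expR lnK ?posrE ?ltr0n// => H.
apply: le_trans H _; rewrite ler_peMl ?expR_ge0// ler1n expn_gt0//.
Qed.

End Counting.

(** * Localization in frequency *)

Section Localization.
Context {R : realType}.
Local Notation C := R[i].
Implicit Types (a d e h s t u x y : R).

Lemma sqr_sin_le y : sin y ^+ 2 <= y ^+ 2.
Proof.
wlog y0 : y / 0 <= y.
  move=> H; have /orP[/H//|y0] := le_total 0 y.
  by have := H (- y); rewrite sinN !sqrrN; apply; rewrite oppr_ge0.
have [c _] : exists2 c, c \in `[0, y] & sin y - sin 0 = cos c * (y - 0).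
  apply: (@MVT_segment _ sin cos) => //.
  by apply: continuous_subspaceT; exact: continuous_sin.
by rewrite sin0 !subr0 => ->; rewrite exprMn ler_piMl ?sqr_ge0.
Qed.

(** By the mean value theorem [sin y = y * cos c] with [c] between 0 and [y], and
    [cos c = 1 - 2 * sin (c / 2) ^ 2] is at least 1/2 there. *)
Lemma sqr_sin_ge y : `|y| <= 1 -> y ^+ 2 / 4 <= sin y ^+ 2.
Proof.
wlog y0 : y / 0 <= y.
  move=> H; have /orP[/H//|y0] := le_total 0 y.
  by have := H (- y); rewrite sinN !sqrrN normrN; apply; rewrite oppr_ge0.
rewrite ger0_norm// => y1.
have [c cy] : exists2 c, c \in `[0, y] & sin y - sin 0 = cos c * (y - 0).
  apply: (@MVT_segment _ sin cos) => //.
  by apply: continuous_subspaceT; exact: continuous_sin.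
rewrite sin0 !subr0 => ->.
move: cy; rewrite in_itv/= => /andP[c0 cy].
have := sqr_sin_le (c / 2); have := cos_mulr2n (c / 2).
rewrite cos2sin2 (_ : (c / 2) *+ 2 = c) => [->|]; last by rewrite -mulr_natr divfK.
move: (sin (c / 2) ^+ 2) => z zc.
have {}zc : z <= 1 / 4 by nra.
have u : 1 / 2 <= (1 - z) *+ 2 - 1 by rewrite [(1 - z) *+ 2]mulr2n; lra.
rewrite exprMn mulrC ler_wpM2r ?sqr_ge0//.
have -> : 4^-1 = (1 / 2) ^+ 2 :> R by field.
by rewrite lerXn2r ?nnegrE//; lra.
Qed.

Lemma bernoulli_ineq u n : 0 <= u <= 1 -> 1 - n%:R * u <= (1 - u) ^+ n.
Proof.
case/andP=> u0 u1; elim: n => [|n IH]; first by rewrite mul0r subr0.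
rewrite exprS; apply: (@le_trans _ _ ((1 - u) * (1 - n%:R * u))).
  rewrite -natr1; have : 0 <= n%:R * u * u by rewrite !mulr_ge0.
  by nra.
by rewrite ler_wpM2l// subr_ge0.
Qed.

(* A power of a cosine, close to the Gaussian [expR (- x ^ 2 / 4)] on
   [|x| <= 2 * m]; multiplying the coefficients of a Dirichlet polynomial by it
   amounts to averaging vertical translates. *)
Definition bump (m : nat) x : R := cos ((2 * m%:R)^-1 * x) ^+ (2 * m ^ 2).

Lemma sqr_bump m x :
  bump m x ^+ 2 = (1 - sin ((2 * m%:R)^-1 * x) ^+ 2) ^+ (2 * m ^ 2).
Proof. by rewrite /bump exprAC cos2sin2. Qed.

(** With [y = x / (2 * m)] in [-1, 1], each factor [1 - sin y ^ 2] is at most [1 - y ^ 2 / 4], hence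
    at most [expR (- (y ^ 2 / 4))]; there are [2 * m ^ 2] factors. *)
Lemma sqr_bump_le m x : (0 < m)%N -> `|x| <= 2 * m%:R ->
  bump m x ^+ 2 <= expR (- (x ^+ 2 / 8)).
Proof.
move=> m0 xm; have mR : 0 < m%:R :> R by rewrite ltr0n.
have m2 : 0 < 2 * m%:R :> R by rewrite mulr_gt0.
rewrite sqr_bump; set y := _ * x.
have y1 : `|y| <= 1.
  by rewrite normrM normfV (gtr0_norm m2) mulrC ler_pdivrMr// mul1r.
have -> : - (x ^+ 2 / 8) = (2 * m ^ 2)%:R * (- (y ^+ 2 / 4)).
  by rewrite /y natrM natrX; field; rewrite gt_eqF.
have s0 : 0 <= 1 - sin y ^+ 2 by rewrite -cos2sin2 sqr_ge0.
rewrite expRM_natl lerXn2r ?nnegrE ?expR_ge0//.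
apply: le_trans (expR_ge1Dx _).
by rewrite lerD2l lerN2 sqr_sin_ge.
Qed.

(** Bernoulli's inequality bounds the power below by [1 - 2 * m ^ 2 * sin y ^ 2], which is at least
    [1 - x ^ 2 / 2]. *)
Lemma sqr_bump_ge m x : (0 < m)%N -> `|x| <= 1 -> 2^-1 <= bump m x ^+ 2.
Proof.
move=> m0 x1; have mR : 0 < m%:R :> R by rewrite ltr0n.
have m1 : 1 <= m%:R :> R by rewrite ler1n.
rewrite sqr_bump; set y := _ * x.
have x2 : x ^+ 2 <= 1 by rewrite -real_normK ?num_real// exprn_ile1.
have yE : y ^+ 2 = x ^+ 2 / (4 * m%:R ^+ 2) by rewrite /y; field; rewrite gt_eqF.
have s01 : 0 <= sin y ^+ 2 <= 1.
  by rewrite sqr_ge0 -(cos2Dsin2 y) lerDr sqr_ge0.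
apply: le_trans (bernoulli_ineq _ s01).
apply: (@le_trans _ _ (1 - (2 * m ^ 2)%:R * y ^+ 2)); last first.
  by rewrite lerD2l lerN2 ler_wpM2l// sqr_sin_le.
have -> : (2 * m ^ 2)%:R * y ^+ 2 = x ^+ 2 / 2.
  by rewrite yE natrM natrX; field; rewrite gt_eqF.
by lra.
Qed.

(** Writing the cosine as half the sum of two conjugate exponentials turns the new series into the
    average of the translates of the old one by [h] and [- h], up to unimodular factors; the mean is
    invariant under shifts. *)
Lemma mean_normc_cos lam N (c : nat -> C) h a :
  mean (fun t =>
    normc (dseries lam N (fun n => c n * (cos (h * (lam n - a)))%:C%C) t))
  <= mean (fun t => normc (dseries lam N c t)).
Proof.
set F := dseries lam N c; set G := dseries _ _ _.
have an H : ctrig H -> ap (fun t => normc (H t)).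
  move=> cH; apply: eq_ap (ap_normc cH ltr01) => t.
  by rewrite powRr1// normc_ge0.
have aF : ap (fun t => normc (F t)) by apply: an; exact: dseries_ctrig.
have FG t : G t = (2^-1)%:C%C *
    (expi (- (h * a)) * F (t + - h) + expi (h * a) * F (t + h)).
  rewrite /G /F /dseries !mulr_sumr -big_split /= mulr_sumr; apply: eq_bigr => n _.
  rewrite mulrCA [X in _ = _ * (_ + X)]mulrCA -mulrDr mulrCA -mulrA.
  congr (_ * _).
  rewrite -!expiD.
  have -> : - (h * a) - lam n * (t - h) = h * (lam n - a) + - (lam n * t) by ring.
  have -> : h * a - lam n * (t + h) = - (h * (lam n - a)) + - (lam n * t) by ring.
  rewrite !expiD -mulrDl mulrA; congr (_ * _).
  by apply: eqC; rewrite !(ReM, ImM, ReD, ImD) /= cosN sinN; field.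
have -> : mean (fun t => normc (F t)) =
    mean (fun t => 2^-1 * (normc (F (t + - h)) + normc (F (t + h)))).
  rewrite meanZ; last by apply: apD; exact: (ap_shift _ aF).
  rewrite meanD; [|exact: (ap_shift _ aF)|exact: (ap_shift _ aF)].
  by rewrite !(mean_shift _ aF); field.
apply: le_mean => [||t]; first by apply: an; exact: dseries_ctrig.
  by apply: apZ; apply: apD; exact: (ap_shift _ aF).
rewrite FG normcM normcR ger0_norm ?invr_ge0// ler_wpM2l ?invr_ge0//.
by apply: le_trans (le_normcD _ _) _; rewrite !normcM !normc_expi !mul1r.
Qed.

Lemma mean_normc_bump lam N (c : nat -> C) m a :
  mean (fun t => normc (dseries lam N (fun n => c n * (bump m (lam n - a))%:C%C) t))
  <= mean (fun t => normc (dseries lam N c t)).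
Proof.
rewrite /bump; elim: (2 * m ^ 2)%N => [|k IH].
  have -> // : (fun n => c n * (cos ((2 * m%:R)^-1 * (lam n - a)) ^+ 0)%:C%C) = c.
  by apply/funext => n; rewrite expr0 rmorph1 mulr1.
apply: le_trans IH.
have -> : (fun n => c n * (cos ((2 * m%:R)^-1 * (lam n - a)) ^+ k.+1)%:C%C) =
  (fun n => c n * (cos ((2 * m%:R)^-1 * (lam n - a)) ^+ k)%:C%C
                * (cos ((2 * m%:R)^-1 * (lam n - a)))%:C%C).
  by apply/funext => n; rewrite exprSr -mulrA; congr (_ * _); rewrite rmorphM.
exact: mean_normc_cos.
Qed.

End Localization.

(** * From the norm of order 1 to the norm of order 2 *)

Section HardyOneTwo.
Context {R : realType}.
Local Notation C := R[i].
Implicit Types (a d e h r s t u x y A B : R).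

Lemma sqr_le_lin_quart x s : 0 <= x -> 0 < s -> x ^+ 2 <= s * x + s ^- 2 * x ^+ 4.
Proof.
move=> x0 s0; have [xs|sx] := leP x s.
  apply: (@le_trans _ _ (s * x)); first by rewrite expr2 ler_wpM2r.
  by rewrite lerDl mulr_ge0 ?exprn_ge0// invr_ge0 exprn_ge0// ltW.
apply: (@le_trans _ _ (s ^- 2 * x ^+ 4)); last by rewrite lerDr mulr_ge0// ltW.
rewrite mulrC ler_pdivlMr ?exprn_gt0// (exprD x 2 2) ler_wpM2l ?sqr_ge0//.
by rewrite lerXn2r ?nnegrE// ltW.
Qed.

Lemma ap_normc1 (F : R -> C) : ctrig F -> ap (fun t => normc (F t)).
Proof.
move=> cF; apply: eq_ap (ap_normc cF ltr01) => t.
by rewrite powRr1// normc_ge0.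
Qed.

Lemma mean_sqr_le (F : R -> C) s : ctrig F -> 0 < s ->
  mean (fun t => normc (F t) ^+ 2) <=
  s * mean (fun t => normc (F t)) + s ^- 2 * mean (fun t => normc (F t) ^+ 4).
Proof.
move=> cF s0; have aF := ap_normc1 cF.
rewrite -!meanZ -?meanD; try by [|exact: apZ|exact: apX|apply: apZ; exact: apX].
apply: le_mean => [||t]; first exact: apX.
  by apply: apD; apply: apZ => //; exact: apX.
by apply: sqr_le_lin_quart => //; exact: normc_ge0.
Qed.

Lemma geometric_sum_le r n : 0 <= r < 1 -> \sum_(j < n) r ^+ j <= (1 - r)^-1.
Proof.
case/andP=> r0 r1; have d0 : 0 < 1 - r by rewrite subr_gt0.
rewrite -[leRHS]mul1r ler_pdivlMr// mulrC -opprB mulNr -subrX1 opprB.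
by rewrite gerBl exprn_ge0.
Qed.

(** Completing the square trades the Gaussian decay for an exponential of any chosen rate [b]. *)
Lemma sqr_bump_exp m x b : (0 < m)%N -> `|x| <= 2 * m%:R ->
  bump m x ^+ 2 <= expR (2 * b ^+ 2) * expR (- (b * x)).
Proof.
move=> m0 xm; apply: le_trans (sqr_bump_le m0 xm) _.
rewrite -expRD ler_expR -subr_ge0.
have -> : 2 * b ^+ 2 + - (b * x) - - (x ^+ 2 / 8) = (x - 4 * b) ^+ 2 / 8 by field.
by rewrite divr_ge0// sqr_ge0.
Qed.

(** Take [A = B * (2 * H + 1)]: the quartic term is then at most [B ^ 2 / 2] and is absorbed on the
    left, after which one factor [B] cancels. *)
Lemma le_self_bound (B m1 S H : R) : 0 <= B -> 0 <= m1 -> 0 < S -> 0 < H ->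
  (forall A, 0 < A -> B ^+ 2 <= S * A * m1 + H * (A ^- 2 * B ^+ 4)) ->
  B <= 2 * S * (2 * H + 1) * m1.
Proof.
move=> B0 m0 S0 H0; have [->|Bn0] := eqVneq B 0.
  by move=> _; rewrite !mulr_ge0// ?addr_ge0 ?mulr_ge0 ?ltW.
have Bp : 0 < B by rewrite lt_neqAle eq_sym Bn0.
set r := 2 * H + 1; have r0 : 0 < r by rewrite /r; lra.
move=> /(_ (B * r)); rewrite mulr_gt0// => /(_ isT).
have -> : (B * r) ^- 2 * B ^+ 4 = B ^+ 2 / r ^+ 2.
  by field; rewrite !gt_eqF.
have Hr : H / r ^+ 2 <= 2^-1.
  by rewrite ler_pdivrMr ?exprn_gt0// /r; nra.
move=> le1; have le2 : B ^+ 2 / 2 <= S * (B * r) * m1.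
  have : H * (B ^+ 2 / r ^+ 2) <= 2^-1 * B ^+ 2.
    by rewrite mulrCA [leRHS]mulrC ler_wpM2l ?sqr_ge0.
  by lra.
rewrite -(ler_pM2l Bp); move: le2; rewrite expr2; nra.
Qed.

Variable lam : nat -> R.
Hypothesis lam_freq : frequency lam.

Lemma hardy_1_2 eta K : 0 < eta -> 0 < K ->
  (forall N (m : {ffun 'I_2 -> 'I_N}),
    #|[pred m' : {ffun 'I_2 -> 'I_N} | wt_sum lam m' == wt_sum lam m]|%:R
      <= K * expR (2 * (eta / 4) * wt_sum lam m)) ->
  exists2 L : R, 0 < L & forall N (c : nat -> C),
    Num.sqrt (\sum_(n < N) normc (translation lam eta c n) ^+ 2) <=
    L * mean (fun t => normc (dseries lam N c t)).
Proof.
move=> eta0 K0 HK.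
(* The decay rate [b] has to yield the factor [expR (- (2 * eta * lam n))] of [B ^ 2] after paying
   [expR (lam n * (eta / 2))] for undoing a translation by [eta / 4]: hence 2 + 1/2. *)
pose b := 5 / 2 * eta.
pose G := expR (2 * b ^+ 2).
(* Ratio of the geometric series that bounds the final sum over [j]: 2 - 7/4 = 1/4. *)
pose r := expR (- (eta / 4)).
have r01 : 0 <= r < 1 by rewrite expR_ge0 expR_lt1 oppr_lt0 divr_gt0.
pose S := (1 - r)^-1.
have S0 : 0 < S by rewrite invr_gt0 subr_gt0; case/andP: r01.
have G0 : 0 < G by exact: expR_gt0.
exists (2 * (2 * S) * (2 * (2 * S * (K * G ^+ 2)) + 1)).
  by rewrite !mulr_gt0// addr_gt0// !mulr_gt0// exprn_gt0.
move=> N c.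
pose w n := normc (c n) ^+ 2.
have w0 n : 0 <= w n by exact: sqr_ge0.
set B := Num.sqrt _; set m1 := mean _.
have m10 : 0 <= m1.
  by apply: mean_ge0 => [|t]; [exact/ap_normc1/dseries_ctrig|exact: normc_ge0].
have B2 : B ^+ 2 = \sum_(n < N) w n * expR (- (2 * eta * lam n)).
  rewrite sqr_sqrtr ?sumr_ge0// => [|n _]; last exact: sqr_ge0.
  apply: eq_bigr => n _; rewrite normc_translation exprMn -expRM_natl.
  by congr (_ * expR _); ring.
(* [J] is both the number of pieces and the parameter of the bump, so that every [lam n - j] lies in
   the range of the Gaussian bound. The final constant does not depend on it. *)
have [J J0 lamJ] : exists2 J, (0 < J)%N & forall n : 'I_N, lam n < J%:R.
  exists (Num.truncn (\sum_(n < N) lam n)).+1 => // n.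
  apply: le_lt_trans (truncnS_gt _); rewrite (bigD1 n)//= lerDl sumr_ge0// => i _.
  exact: frequency_ge0.
have lam0 n : 0 <= lam n by exact: frequency_ge0.
apply: le_self_bound => //; first exact: sqrtr_ge0.
- by rewrite mulr_gt0.
- by rewrite !mulr_gt0 ?exprn_gt0.
move=> A A0.
pose cj j n := c n * (bump J (lam n - j%:R))%:C%C.
have near_j (n : 'I_N) (j : 'I_J) : `|lam n - j%:R| <= 2 * J%:R.
  have := lamJ n; have := lam0 n; have : (j%:R : R) < J%:R by rewrite ltr_nat.
  have : 0 <= j%:R :> R by [].
  by rewrite ler_norml; lra.
have normc_cj j n : normc (cj j n) ^+ 2 = w n * bump J (lam n - j%:R) ^+ 2.
  by rewrite normcM normcR exprMn real_normK ?num_real.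
have quart (j : 'I_J) : mean (fun t => normc (dseries lam N (cj j) t) ^+ 4) <=
    K * (G ^+ 2 * expR (eta * 5 * j%:R) * B ^+ 4).
  (* Undoing a translation by [eta / 4] presents the piece as a translate, to which the
     fourth-moment estimate applies. *)
  pose c' n := cj j n * (expR (lam n * (eta / 4)))%:C%C.
  have -> : cj j = translation lam (eta / 4) c'.
    apply/funext => n; rewrite /translation /c' -mulrA -rmorphM /=.
    by rewrite -expRD subrr expR0 rmorph1 mulr1.
  apply: le_trans (mean_dseries_le c' (HK N)) _.
  rewrite ler_pM2l//.
  have -> : G ^+ 2 * expR (eta * 5 * j%:R) * B ^+ 4 =
      (G * expR (b * j%:R) * B ^+ 2) ^+ 2.
    have -> : expR (eta * 5 * j%:R) = expR (b * j%:R) ^+ 2.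
      by rewrite -expRM_natl; congr expR; rewrite /b; field.
    by ring.
  apply: lerXn2r; rewrite ?nnegrE.
  - by apply: sumr_ge0 => n _; exact: sqr_ge0.
  - by rewrite pmulr_rge0 ?sqr_ge0// mulr_gt0 ?expR_gt0.
  rewrite B2 mulr_sumr; apply: ler_sum => n _.
  rewrite normcM exprMn normc_cj normcR ger0_norm ?expR_ge0//.
  rewrite -[leLHS]mulrA [leRHS]mulrCA; apply: ler_wpM2l => //.
  apply: (@le_trans _ _ (G * expR (- (b * (lam n - j%:R))) *
      expR (lam n * (eta / 4)) ^+ 2)).
    apply: ler_wpM2r; first exact: sqr_ge0.
    exact: sqr_bump_exp.
  rewrite -expRM_natl -!mulrA ler_pM2l// -!expRD ler_expR le_eqVlt.
  by apply/orP; left; apply/eqP; rewrite /b; field.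
(* With weights [expR (- (2 * eta * j))], the exponent in [A_j] must be below 2 for the linear terms
   to be summable and above 3/2 for the quartic ones; 7/4 lies midway. *)
have sq (j : 'I_J) : \sum_(n < N) w n * bump J (lam n - j%:R) ^+ 2 <=
    A * expR (7 / 4 * eta * j%:R) * m1
    + (A * expR (7 / 4 * eta * j%:R)) ^- 2 *
      (K * (G ^+ 2 * expR (eta * 5 * j%:R) * B ^+ 4)).
  have -> : \sum_(n < N) w n * bump J (lam n - j%:R) ^+ 2 =
      mean (fun t => normc (dseries lam N (cj j) t) ^+ 2).
    rewrite mean_sqr_dseries; last exact: frequency_inj.
    by apply: eq_bigr => n _; rewrite normc_cj.
  have s0 : 0 < A * expR (7 / 4 * eta * j%:R) by rewrite mulr_gt0 ?expR_gt0.
  apply: le_trans (mean_sqr_le (dseries_ctrig _ _ _) s0) _.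
  apply: lerD; first by rewrite ler_pM2l//; exact: mean_normc_bump.
  by rewrite ler_pM2l ?invr_gt0 ?exprn_gt0.
have -> : 2 * S * A * m1 + 2 * S * (K * G ^+ 2) * (A ^- 2 * B ^+ 4) =
    2 * (A * m1 + A ^- 2 * (K * (G ^+ 2 * B ^+ 4))) * S by ring.
set V := A * m1 + _.
have V0' : 0 <= A ^- 2 * (K * (G ^+ 2 * B ^+ 4)).
  rewrite pmulr_rge0 ?invr_gt0 ?exprn_gt0// pmulr_rge0// pmulr_rge0 ?exprn_gt0//.
  exact/exprn_ge0/sqrtr_ge0.
have V0 : 0 <= V by apply: addr_ge0 => //; apply: mulr_ge0 => //; exact: ltW.
apply: (@le_trans _ _ (2 * V * \sum_(j < J) r ^+ j)); last first.
  by apply: ler_wpM2l; [exact: mulr_ge0|exact: geometric_sum_le].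
rewrite B2 mulr_sumr.
(* For each [n] the single piece [j = truncn (lam n)] suffices: its squared bump is at least 1/2,
   which the factor 2 offsets, and [j <= lam n] compares the exponentials. *)
apply: (@le_trans _ _ (\sum_(j < J) \sum_(n < N) 2 *
    (expR (- (2 * eta * j%:R)) * (w n * bump J (lam n - j%:R) ^+ 2)))).
  rewrite exchange_big /=; apply: ler_sum => n _.
  have tj : (Num.truncn (lam n) < J)%N by rewrite truncn_lt_nat// lamJ.
  rewrite (bigD1 (Ordinal tj))//=.
  apply: ler_wpDr.
    apply: sumr_ge0 => j _; apply: mulr_ge0 => //.
    apply: mulr_ge0; first exact: expR_ge0.
    by apply: mulr_ge0 => //; exact: sqr_ge0.
  have /andP[t1 t2] := truncn_itv (lam0 n).
  have b1 : `|lam n - (Num.truncn (lam n))%:R| <= 1.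
    rewrite ger0_norm ?subr_ge0//.
    by move: t2; rewrite -natr1; lra.
  have bg := sqr_bump_ge J0 b1.
  have e1 : expR (- (2 * eta * lam n)) <=
      expR (- (2 * eta * (Num.truncn (lam n))%:R)).
    by rewrite ler_expR lerN2 ler_pM2l// mulr_gt0.
  apply: (@le_trans _ _ (w n * (expR (- (2 * eta * (Num.truncn (lam n))%:R)) *
      (2 * bump J (lam n - (Num.truncn (lam n))%:R) ^+ 2)))); last first.
    have E x y z : x * (y * (2 * z)) = 2 * (y * (x * z)) by ring.
    by rewrite E.
  apply: ler_wpM2l => //; apply: le_trans e1 _.
  by rewrite -[leLHS]mulr1 ler_pM2l ?expR_gt0//; lra.
apply: ler_sum => j _; rewrite -mulr_sumr -[leRHS]mulrA ler_pM2l// -mulr_sumr.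
apply: (@le_trans _ _ _ _ _ (ler_wpM2l (expR_ge0 _) (sq j))).
have rj : r ^+ j = expR (- (eta / 4 * j%:R)).
  by rewrite /r -expRM_natl; congr expR; ring.
have rE : expR (- (2 * eta * j%:R)) * expR (7 / 4 * eta * j%:R) = r ^+ j.
  by rewrite rj -expRD; congr expR; field.
rewrite mulrDr [leRHS]mulrDl; apply: lerD.
  by rewrite -rE le_eqVlt; apply/orP; left; apply/eqP; ring.
have -> : (A * expR (7 / 4 * eta * j%:R)) ^- 2 =
    A ^- 2 * expR (- (7 / 2 * eta * j%:R)).
  rewrite exprMn invfM -[expR _ ^+ 2]expRM_natl -expRN.
  by congr (_ * expR _); field.
have -> : expR (- (2 * eta * j%:R)) * (A ^- 2 * expR (- (7 / 2 * eta * j%:R)) *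
     (K * (G ^+ 2 * expR (eta * 5 * j%:R) * B ^+ 4))) =
   A ^- 2 * (K * (G ^+ 2 * B ^+ 4)) * (expR (- (2 * eta * j%:R)) *
    expR (- (7 / 2 * eta * j%:R)) * expR (eta * 5 * j%:R)) by ring.
(* The exponents add up to -2 - 7/2 + 5 = -1/2 times [eta * j], below the -1/4 of [r ^+ j]. *)
rewrite -!expRD; apply: ler_wpM2l => //.
rewrite rj ler_expR.
have : 0 <= eta * j%:R by rewrite mulr_ge0// ltW.
by lra.
Qed.

End HardyOneTwo.

(** * Extension to the completion *)

Section Completion.
Context {R : realType}.
Local Notation C := R[i].
Variable lam : nat -> R.
Implicit Types (D E : {poly C}) (a b : nat -> C) (p q sigma x y e : R).

Lemma dirichlet_vertical_widen D N t : (size D <= N)%N ->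
  dirichlet_vertical lam D t = dseries lam N (fun n => D`_n) t.
Proof.
move=> DN; rewrite /dirichlet_vertical /dseries.
rewrite (big_ord_widen N (fun n => D`_n * expi (- (lam n * t)))) //.
rewrite big_mkcond; apply: eq_bigr => n _; case: ltnP => // Dn.
by rewrite nth_default ?mul0r.
Qed.

Lemma dirichlet_verticalD D E t : dirichlet_vertical lam (D + E) t =
  dirichlet_vertical lam D t + dirichlet_vertical lam E t.
Proof.
pose N := maxn (size D) (size E).
rewrite !(@dirichlet_vertical_widen _ N) ?leq_maxl ?leq_maxr ?size_polyD//.
by rewrite /dseries -big_split; apply: eq_bigr => n _; rewrite coefD mulrDl.
Qed.

Lemma dirichlet_verticalN D t :
  dirichlet_vertical lam (- D) t = - dirichlet_vertical lam D t.
Proof.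
rewrite /dirichlet_vertical size_polyN -sumrN; apply: eq_bigr => n _.
by rewrite coefN mulNr.
Qed.

#[local] Opaque dirichlet_norm.

Lemma dirichlet_norm_ge0 p D : 1 <= p -> 0 <= dirichlet_norm lam p D.
Proof. by move=> p1; rewrite dirichlet_normE// pnorm_ge0. Qed.

Lemma dirichlet_normD p D E : 1 <= p ->
  dirichlet_norm lam p (D + E) <= dirichlet_norm lam p D + dirichlet_norm lam p E.
Proof.
move=> p1; rewrite !dirichlet_normE//.
rewrite (_ : dirichlet_vertical lam (D + E) = fun t =>
  dirichlet_vertical lam D t + dirichlet_vertical lam E t).
  by apply: pnormD => //; exact: dirichlet_vertical_ctrig.
by apply/funext => t; rewrite dirichlet_verticalD.
Qed.

Lemma dirichlet_normN p D : 1 <= p ->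
  dirichlet_norm lam p (- D) = dirichlet_norm lam p D.
Proof.
move=> p1; rewrite (dirichlet_normE lam (- D) p1) (dirichlet_normE lam D p1).
rewrite /pnorm /pmean.
suff -> : (fun t => normc (dirichlet_vertical lam (- D) t) `^ p) =
  (fun t => normc (dirichlet_vertical lam D t) `^ p) by [].
by apply/funext => t; rewrite dirichlet_verticalN normcN.
Qed.

Lemma dirichlet_normB p D E : 1 <= p ->
  `|dirichlet_norm lam p D - dirichlet_norm lam p E| <= dirichlet_norm lam p (D - E).
Proof.
have H (x y z : R) : x <= z + y -> y <= z + x -> `|x - y| <= z.
  by move=> *; rewrite ler_norml; lra.
move=> p1; apply: H.
  by have := dirichlet_normD (D - E) E p1; rewrite subrK.
have := dirichlet_normD (E - D) D p1.
by rewrite subrK -(opprB D E) (dirichlet_normN (D - E) p1).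
Qed.

Lemma dirichlet_cauchyB p (D E : nat -> {poly C}) : 1 <= p ->
  dirichlet_cauchy lam p D -> dirichlet_cauchy lam p E ->
  dirichlet_cauchy lam p (fun j => D j - E j).
Proof.
move=> p1 cD cE e e0; have e2 : 0 < e / 2 by rewrite divr_gt0.
have [M HM] := cD _ e2; have [N HN] := cE _ e2.
exists (maxn M N) => j k; rewrite !geq_max => /andP[Mj Nj] /andP[Mk Nk].
have -> : D j - E j - (D k - E k) = (D j - D k) + - (E j - E k) by ring.
apply: le_lt_trans (dirichlet_normD _ _ p1) _; rewrite (dirichlet_normN _ p1).
by rewrite [ltRHS]splitr; apply: ltrD; [exact: HM|exact: HN].
Qed.

Lemma dirichlet_cauchy_cvg p (D : nat -> {poly C}) : 1 <= p ->
  dirichlet_cauchy lam p D -> cvg (dirichlet_norm lam p (D j) @[j --> \oo]).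
Proof.
move=> p1 cD; apply/cauchy_cvgP/cauchy_exP => e e0.
have [N HN] := cD _ e0.
exists (dirichlet_norm lam p (D N)); exists N => // j /= Nj.
rewrite -ball_normE /=.
exact: le_lt_trans (dirichlet_normB _ _ p1) (HN _ _ (leqnn N) Nj).
Qed.

Lemma representsB p (D E : nat -> {poly C}) a b : 1 <= p ->
  represents lam p D a -> represents lam p E b ->
  represents lam p (fun j => D j - E j) (fun n => a n - b n).
Proof.
move=> p1 [cD Da] [cE Eb]; split=> [|n]; first exact: dirichlet_cauchyB.
apply: (@squeeze_cvgr _ _ _ _ (fun=> 0)
  (fun j => normc ((D j)`_n - a n) + normc ((E j)`_n - b n))).
- near=> j; rewrite normc_ge0 coefB /=.
  have -> : (D j)`_n - (E j)`_n - (a n - b n) =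
    ((D j)`_n - a n) + - ((E j)`_n - b n) by ring.
  by apply: le_trans (le_normcD _ _) _; rewrite normcN.
- exact: cvg_cst.
- by rewrite -[X in _ --> X](addr0 (0 : R)); exact: (cvgD (Da n) (Eb n)).
Unshelve. all: by end_near.
Qed.

Definition poly_translation sigma D : {poly C} :=
  \poly_(n < size D) translation lam sigma (fun n => D`_n) n.

Lemma coef_poly_translation sigma D n :
  (poly_translation sigma D)`_n = translation lam sigma (fun n => D`_n) n.
Proof.
rewrite coef_poly; case: ltnP => // Dn.
by rewrite /translation nth_default ?mul0r.
Qed.

Lemma dirichlet_vertical_translation sigma D :
  dirichlet_vertical lam (poly_translation sigma D) =
  dseries lam (size D) (translation lam sigma (fun n => D`_n)).
Proof.
apply/funext => t; rewrite (dirichlet_vertical_widen _ (size_poly _ _)).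
by apply: eq_bigr => n _; rewrite coef_poly_translation.
Qed.

Lemma poly_translationB sigma D E :
  poly_translation sigma (D - E) =
  poly_translation sigma D - poly_translation sigma E.
Proof.
apply/polyP => n; rewrite coefB !coef_poly_translation /translation coefB.
by rewrite mulrBl.
Qed.

(** The bound applied to differences carries Cauchy sequences to Cauchy sequences, and each
    coefficient is only multiplied by a fixed number. *)
Lemma represents_translation p q sigma L (D : nat -> {poly C}) a : 0 < L ->
  (forall E, dirichlet_norm lam q (poly_translation sigma E) <=
    L * dirichlet_norm lam p E) ->
  represents lam p D a ->
  represents lam q (fun j => poly_translation sigma (D j)) (translation lam sigma a).
Proof.
move=> L0 HL [cD Da]; split=> [e e0|n].
  have [N HN] := cD _ (divr_gt0 e0 L0); exists N => j k Nj Nk.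
  rewrite -poly_translationB; apply: le_lt_trans (HL _) _.
  by rewrite mulrC -ltr_pdivlMr// HN.
rewrite (_ : (fun j => _) = fun j =>
  normc ((D j)`_n - a n) * expR (- (lam n * sigma))).
  rewrite -[X in _ --> X](mul0r (expR (- (lam n * sigma)))).
  by apply: cvgM; [exact: Da|exact: cvg_cst].
apply/funext => j; rewrite coef_poly_translation /translation -mulrBl.
by rewrite normcM normcR ger0_norm ?expR_ge0.
Qed.

(** By linearity, continuity reduces to the norm of [b - a]: a representing sequence nearly
    attaining its infimum has a translate that competes in the infimum for [q]. *)
Lemma hypercontractive_of_bound :
  (forall p q sigma, 1 <= p -> p < q -> 0 < sigma ->
    exists2 L : R, 0 < L & forall E,
      dirichlet_norm lam q (poly_translation sigma E)
        <= L * dirichlet_norm lam p E) ->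
  hypercontractive lam.
Proof.
move=> bound p q sigma p1 pq sigma0.
have q1 : 1 <= q by rewrite (le_trans p1)// ltW.
have [L L0 HL] := bound p q sigma p1 pq sigma0.
split=> [a [D Da]|a [Da aD] e e0].
  exists (fun j => poly_translation sigma (D j)).
  exact: represents_translation L0 HL Da.
exists (e / L) => [|b [Db bD] ltd]; first exact: divr_gt0.
have [r [D [rD Dr]] rd] : exists2 r : R,
    (exists D : nat -> {poly C}, represents lam p D (fun n => b n - a n) /\
      dirichlet_norm lam p (D j) @[j --> \oo] --> r) & r < e / L.
  (* The infimum is approached only over a non-empty set; the differences of the two given sequences
     provide a member. *)
  apply: inf_lt ltd; eexists; exists (fun j => Db j - Da j); split.
    exact: representsB.
  apply: dirichlet_cauchy_cvg => //.
  by apply: dirichlet_cauchyB => //; [case: bD|case: aD].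
have rT := represents_translation L0 HL rD.
have cT := dirichlet_cauchy_cvg q1 (proj1 rT).
apply: (@le_lt_trans _ _
  (lim (dirichlet_norm lam q (poly_translation sigma (D j)) @[j --> \oo]))).
  apply: ge_inf.
    exists 0 => x [E [_ Ex]]; rewrite -(cvg_lim _ Ex)//.
    apply: limr_ge; first exact: cvgP Ex.
    by near=> j; exact: dirichlet_norm_ge0.
  exists (fun j => poly_translation sigma (D j)); split => //.
  rewrite (_ : (fun n => _) = translation lam sigma (fun n => b n - a n)) //.
  by apply/funext => n; rewrite /translation mulrBl.
apply: (@le_lt_trans _ _ (L * r)); last by rewrite mulrC -ltr_pdivlMr.
have LDr : L * dirichlet_norm lam p (D j) @[j --> \oo] --> L * r.
  by apply: cvgM => //; exact: cvg_cst.
rewrite -(cvg_lim _ LDr)//; apply: ler_lim => //; first exact: cvgP LDr.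
by near=> j; exact: HL.
Unshelve. all: by end_near.
Qed.

(** * Norm inequalities from the counting hypothesis *)

Hypothesis lam_freq : frequency lam.
Hypothesis lam_count : forall k : nat, (0 < k)%N ->
  ln (sum_repr_count lam k mu)%:R / mu
    @[mu --> within [set mu | sum_repr lam k mu !=set0] +oo] --> (0 : R).

(** The [2 * k]-th root of [mean_dseries_le], with the multiplicities controlled by
    [card_wt_sum_bound]. *)
Lemma hardy_2_even k sigma : (0 < k)%N -> 0 < sigma ->
  exists2 L : R, 0 < L & forall N (c : nat -> C),
    pnorm (2 * k)%:R (dseries lam N (translation lam sigma c)) <=
    L * Num.sqrt (\sum_(n < N) normc (c n) ^+ 2).
Proof.
move=> k0 sigma0.
have [K K0 HK] := card_wt_sum_bound lam_freq sigma0 (lam_count k0).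
pose p : R := (2 * k)%:R.
have p0 : 0 < p by rewrite ltr0n muln_gt0.
exists (K `^ p^-1) => [|N c]; first exact: powR_gt0.
set B := Num.sqrt _.
have B0 : 0 <= B by exact: sqrtr_ge0.
have le1 : pmean p (dseries lam N (translation lam sigma c)) <= K * B `^ p.
  apply: le_trans (le_trans (mean_dseries_le c (HK N)) _).
    rewrite /pmean le_eqVlt; apply/orP; left; apply/eqP; congr mean.
    by apply/funext => t; rewrite powR_mulrn ?normc_ge0.
  rewrite ler_pM2l// powR_mulrn// exprM sqr_sqrtr//.
  by apply: sumr_ge0 => n _; exact: sqr_ge0.
have pV0 : 0 <= p^-1 by rewrite invr_ge0 ltW.
have cT := dseries_ctrig lam N (translation lam sigma c).
have := ge0_ler_powR pV0 _ _ le1.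
rewrite !nnegrE pmean_ge0// mulr_ge0 ?powR_ge0 ?(ltW K0)// => /(_ isT isT).
rewrite powRM ?powR_ge0 ?(ltW K0)// -(powRrM B) mulfV ?gt_eqF// powRr1//.
Qed.

(** Half of the translation passes from order 1 to order 2, the other half from order 2 to an even
    order [2 * k >= q]; monotonicity of the norms in the order covers [p] and [q]. *)
Lemma translation_bound p q sigma : 1 <= p -> p < q -> 0 < sigma ->
  exists2 L : R, 0 < L & forall E,
    dirichlet_norm lam q (poly_translation sigma E) <= L * dirichlet_norm lam p E.
Proof.
move=> p1 pq sigma0.
have p0 : 0 < p by rewrite (lt_le_trans ltr01).
have q0 : 0 < q by rewrite (lt_trans p0).
have s2 : 0 < sigma / 2 by rewrite divr_gt0.
(* [hardy_1_2] with [eta = sigma / 2] asks for the pair count at rate [eta / 4]. *)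
have s8 : 0 < sigma / 2 / 4 by rewrite divr_gt0.
pose k := (Num.truncn q).+1.
have [L1 L10 H1] := hardy_2_even (ltn0Sn _ : (0 < k)%N) s2.
have [K K0 HK] := card_wt_sum_bound lam_freq s8 (lam_count (isT : (0 < 2)%N)).
have [L2 L20 H2] := hardy_1_2 lam_freq s2 K0 HK.
exists (L1 * L2) => [|E]; first exact: mulr_gt0.
have q1 : 1 <= q by rewrite (le_trans p1)// ltW.
rewrite !dirichlet_normE// dirichlet_vertical_translation.
pose c n := E`_n.
have cE : ctrig (dirichlet_vertical lam E) by exact: dirichlet_vertical_ctrig.
have -> : translation lam sigma c =
    translation lam (sigma / 2) (translation lam (sigma / 2) c).
  apply/funext => n; rewrite /translation -mulrA -rmorphM /= -expRD.
  by congr (_ * (expR _)%:C%C); field.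
have qk : q <= (2 * k)%:R.
  apply: (@le_trans _ _ k%:R); first by apply: ltW; rewrite truncnS_gt.
  by rewrite ler_nat leq_pmull.
apply: le_trans (le_pnorm (dseries_ctrig _ _ _) q0 qk) _.
apply: le_trans (H1 _ _) _; rewrite -mulrA ler_pM2l//.
apply: le_trans (H2 _ _) _; rewrite ler_pM2l//.
apply: le_trans (le_pnorm cE ltr01 p1).
rewrite /pnorm invr1 powRr1; last exact: pmean_ge0.
rewrite le_eqVlt; apply/orP; left; apply/eqP; congr mean; apply/funext => t.
by rewrite powRr1 ?normc_ge0.
Qed.

End Completion.

Theorem corollary1p2 (R : realType) (lam : nat -> R)
    (lam_freq : frequency lam)
    (lam_count : forall k : nat, (0 < k)%N ->
      ln (sum_repr_count lam k mu)%:R / mu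
        @[mu --> within [set mu | sum_repr lam k mu !=set0] +oo] --> (0 : R)) :
  hypercontractive lam.
Proof.
apply: hypercontractive_of_bound => p q sigma.
exact: translation_bound.
Qed.
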